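(* Let $a,b,\theta\in\mathbb{R}$ with $|\theta|<2b\pi$, $a\neq 0$ and $b>0$. Then the following four identities hold: $$b^2\pi^2\sum_{n=1}^\infty \frac{\cosh(\theta n/a)}{\sinh^2(bn\pi/a)}(-1)^n+\theta \pi a \sum_{n=1}^\infty \frac{\sin(n\theta/b)}{\sinh(an\pi/b)}+a^2\pi^2\sum_{n=1}^\infty \frac{\cos(n\theta/b)\cosh(an\pi/b)}{\sinh^2(an\pi/b)} +\frac{\theta^2}{4}+\frac{\zeta(2)}{2}(a^2-2b^2)=0,$$ $$b^2\pi^2\sum_{n=1}^\infty\frac{\sinh\left(\frac{(2n-1)\theta}{2a}\right)}{\cosh^2\left(\frac{(2n-1)\pi b}{2a}\right)}(-1)^n-\theta \pi a \sum_{n=1}^\infty \frac{\cos\left(\frac{(2n-1)\theta}{2b}\right)}{\cosh\left(\frac{(2n-1)\pi a}{2b}\right)}+a^2\pi^2\sum_{n=1}^\infty \frac{\sin\left(\frac{(2n-1)\theta}{2b}\right)\sinh\left(\frac{(2n-1)\pi a}{2b}\right)}{\cosh^2\left(\frac{(2n-1)\pi a}{2b}\right)}=0,$$ $$b^2\pi^2\sum_{n=1}^\infty \frac{\cosh(n\theta/a)}{\cosh^2(n\pi b/a)}(-1)^n-a\pi \theta \sum_{n=1}^\infty \frac{\sin\left(\frac{(2n-1)\theta}{2b}\right)}{\sinh\left(\frac{(2n-1)\pi a}{2b}\right)}-a^2\pi^2\sum_{n=1}^\infty \frac{\cos\left(\frac{(2n-1)\theta}{2b}\right)\cosh\left(\frac{(2n-1)\pi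 a}{2b}\right)}{\sinh^2\left(\frac{(2n-1)\pi a}{2b}\right)}+\frac{b^2\pi^2}{2}=0,$$ $$b^2\pi^2\sum_{n=1}^\infty \frac{\sinh\left(\frac{(2n-1)\theta}{2a}\right)}{\sinh^2\left(\frac{(2n-1)b\pi}{2a}\right)}(-1)^n+a\pi \theta \sum_{n=1}^\infty\frac{\cos(n\theta/b)}{\cosh(n\pi a/b)}-a^2\pi^2\sum_{n=1}^\infty\frac{\sin(n\theta/b)\sinh(n\pi a/b)}{\cosh^2(n\pi a/b)}+\frac{a\theta \pi}{2}=0.$$
   Context: $\zeta$ is the Riemann zeta function, so $\zeta(2)=\pi^2/6$. *)

(* Defs.v *)
From Stdlib Require Import Reals.
From Coquelicot Require Import Coquelicot.
Local Open Scope R_scope.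

(* u 1 + u 2 + u 3 + ... converges, with sum l. *)
Definition is_series_from1 (u : nat -> R) (l : R) : Prop :=
  is_series (fun k => u (S k)) l.

(* The Riemann zeta function on the real half-line s > 1, given there by its
   Dirichlet series; the value at s <= 1 is junk (not the analytic
   continuation). *)
Definition zeta (s : R) : R := Series (fun k => / Rpower (INR (S k)) s).

(* Main.v *)
(** Write [c_k = k / r], and for [x > 0] and [0 < phi < 2 PI] let
    [P0 x phi = sum_n 2 x cos (n phi) / (n^2 + x^2)] and
    [P1 x phi = sum_n 2 n sin (n phi) / (n^2 + x^2)], with closed forms the Fourier
    expansions of [cosh (x (PI - phi))] and [sinh (x (PI - phi))]; let [Q0], [Q1] be
    their derivatives in [x]. Then [PI^2 cosh (c phi) / sinh (c PI)^2] equals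
    [1 / c^2 - Q0 c phi - phi P1 c phi], and similarly for [sinh]. The same
    expansions serve both to expand in [n] at [c = c_k] and to resum over [k] with
    weights [cos (k psi)] or [sin (k psi)], so the identities amount to exchanging
    the two summations, which is done with Dirichlet's test ([exchange]) after an
    Abel summation when the terms only decay like [1 / (n + c)]. The choice
    [psi = PI] gives the first identity, [psi = PI / 2] the fourth. The third and
    the second are the first and the fourth at [b] minus the same at [2 b], since
    [1 / cosh^2 x = 1 / sinh^2 x - 4 / sinh^2 (2 x)]. *)
Require Import Defs.
From Stdlib Require Import Reals Lra Lia.
From Coquelicot Require Import Coquelicot.
Local Open Scope R_scope.


Local Notation idx n := (INR (S n)) (only parsing).

(** The scaling used is [r = a / b], [phi = theta / b]. The obstacle is that the double series has
    terms of size (n + k)^-2, or (n + k)^-1 for the [P] pair, so it is not absolutely summable in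
    general and Fubini is of no help. What saves the exchange is oscillation in k alone: for [psi]
    strictly between 0 and 2 PI the weights have bounded partial sums, and although the kernels
    change sign, both their size and their increments in k are controlled by one decreasing majorant
    C / (n + t)^2. In n only boundedness of the weights is used, which lets the cosine case include
    [phi = 0]. Each Fourier expansion compares the point [phi] with the point PI, so constants may
    stay undetermined; they are fixed afterwards by letting [phi] tend to 0. The polynomial terms of
    the identities come from the poles 1 / x^2 in [Q0] and 1 / x in [P0], whose weighted sums are
    the elementary series of cos (n phi) / n^2 and sin (n phi) / n. *)

Lemma idx_ge1 n : 1 <= idx n.
Proof. rewrite S_INR; pose proof (pos_INR n); lra. Qed.

Lemma idx_S n : idx (S n) = idx n + 1.
Proof. exact (S_INR (S n)). Qed.

(** * Real series: domination, limits under the sum, differentiation *)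

Lemma sum_n_RS (u : nat -> R) n : sum_n u (S n) = sum_n u n + u (S n).
Proof. exact (sum_Sn u n). Qed.

Lemma sum_n_R0 (u : nat -> R) : sum_n u 0 = u 0%nat.
Proof. exact (sum_O u). Qed.

Lemma series_plus (u v : nat -> R) (l m : R) :
  is_series u l -> is_series v m -> is_series (fun n => u n + v n) (l + m).
Proof. intros; apply (is_series_plus u v l m); auto. Qed.

Lemma series_scal (c : R) (u : nat -> R) (l : R) :
  is_series u l -> is_series (fun n => c * u n) (c * l).
Proof. intros; apply (is_series_scal c u l); auto. Qed.

Lemma series_eq (u v : nat -> R) (l m : R) :
  is_series u l -> (forall n, u n = v n) -> l = m -> is_series v m.
Proof. intros H E <-; apply (is_series_ext u); auto. Qed.

Lemma series_unique (u : nat -> R) (l m : R) :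
  is_series u l -> is_series u m -> l = m.
Proof. intros H1 H2; rewrite <- (is_series_unique _ _ H1); apply is_series_unique, H2. Qed.

Lemma is_lim_seq_close (u v : nat -> R) (l : R) :
  is_lim_seq v l -> is_lim_seq (fun n => u n - v n) 0 -> is_lim_seq u l.
Proof.
intros Hv Hd.
replace l with (l + 0) by ring.
apply is_lim_seq_ext with (fun n => v n + (u n - v n)); [intros; ring|].
now apply is_lim_seq_plus'.
Qed.

Lemma is_lim_seq_small (u v : nat -> R) :
  is_lim_seq v 0 -> (forall n, Rabs (u n) <= v n) -> is_lim_seq u 0.
Proof.
intros Hv Hu; apply is_lim_seq_abs_0.
apply is_lim_seq_le_le with (fun _ => 0) v; auto using is_lim_seq_const.
intros n; split; [apply Rabs_pos | apply Hu].
Qed.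

Lemma is_lim_seq_R_unique (u : nat -> R) (l m : R) :
  is_lim_seq u l -> is_lim_seq u m -> l = m.
Proof.
intros H1 H2; apply is_lim_seq_unique in H1; apply is_lim_seq_unique in H2.
rewrite H1 in H2; now injection H2.
Qed.

Lemma is_lim_seq_scal_0 (K : R) (v : nat -> R) :
  is_lim_seq v 0 -> is_lim_seq (fun n => K * v n) 0.
Proof.
intros H; replace (Finite 0) with (Rbar_mult K 0) by (simpl; f_equal; ring).
now apply is_lim_seq_scal_l.
Qed.

Lemma is_lim_seq_inv_idx : is_lim_seq (fun n => / idx n) 0.
Proof.
replace (Finite 0) with (Rbar_inv p_infty) by reflexivity.
apply is_lim_seq_inv; [|discriminate].
apply (is_lim_seq_incr_1 INR), is_lim_seq_INR.
Qed.

Lemma sum_n_scal_R (c : R) (u : nat -> R) N : sum_n (fun n => c * u n) N = c * sum_n u N.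
Proof. induction N; [rewrite !sum_n_R0|rewrite !sum_n_RS, IHN]; lra. Qed.

(** Telescoping. The explicit bound 1 / c that follows is what makes the error in [exchange] vanish
    as c grows. *)
Lemma sum_n_inv_sq_le (c : R) N :
  0 < c -> sum_n (fun n => / (idx n + c) ^ 2) N <= / c - / (idx N + c).
Proof.
intros Hc.
assert (step : forall x, c <= x -> / (x + 1) ^ 2 <= / x - / (x + 1)).
{ intros x Hx.
  replace (/ x - / (x + 1)) with (/ (x * (x + 1))) by (field; lra).
  apply Rinv_le_contravar; nra. }
induction N.
- rewrite sum_n_R0; simpl INR; pose proof (step c (Rle_refl _)).
  replace (1 + c) with (c + 1) by ring; lra.
- rewrite sum_n_RS, idx_S; pose proof (idx_ge1 N).
  replace (idx N + 1 + c) with (idx N + c + 1) by ring.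
  pose proof (step (idx N + c)); lra.
Qed.

Lemma sum_n_inv_sq_bound (c : R) N :
  0 < c -> sum_n (fun n => / (idx n + c) ^ 2) N <= / c.
Proof.
intros Hc; pose proof (sum_n_inv_sq_le c N Hc); pose proof (idx_ge1 N).
assert (0 < / (idx N + c)) by (apply Rinv_0_lt_compat; lra); lra.
Qed.

Lemma ex_series_nonneg (u : nat -> R) (B : R) :
  (forall n, 0 <= u n) -> (forall N, sum_n u N <= B) -> ex_series u.
Proof.
intros H0 HB.
destruct (ex_finite_lim_seq_incr (sum_n u) B) as [l Hl]; auto.
- intros n; rewrite sum_n_RS; specialize (H0 (S n)); lra.
- now exists l.
Qed.

Lemma ex_series_abs_le (u v : nat -> R) :
  (forall n, Rabs (u n) <= v n) -> ex_series v -> ex_series u.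
Proof. intros H; apply (ex_series_le u v); exact H. Qed.

Lemma ex_series_inv_sq : ex_series (fun n => / idx n ^ 2).
Proof.
(* The telescoping bound needs a positive shift, so the shift 1 is used; n + 1 <= 2 n costs the
   factor 4. *)
apply ex_series_abs_le with (fun n => 4 * / (idx n + 1) ^ 2).
- intros n; pose proof (idx_ge1 n).
  rewrite Rabs_pos_eq by (apply Rlt_le, Rinv_0_lt_compat; nra).
  replace (4 * / (idx n + 1) ^ 2) with (/ ((idx n + 1) / 2) ^ 2) by (field; lra).
  apply Rinv_le_contravar; nra.
- destruct (ex_series_nonneg (fun n => / (idx n + 1) ^ 2) (/ 1)) as [l Hl].
  + intros n; pose proof (idx_ge1 n); apply Rlt_le, Rinv_0_lt_compat; nra.
  + intros N; apply sum_n_inv_sq_bound; lra.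
  + exists (4 * l); now apply series_scal.
Qed.

Lemma ex_series_scal_R (c : R) (u : nat -> R) :
  ex_series u -> ex_series (fun n => c * u n).
Proof. intros [l Hl]; exists (c * l); now apply series_scal. Qed.

Lemma Series_tail_bound (u v : nat -> R) (l m : R) N :
  is_series u l -> is_series v m -> (forall n, Rabs (u n) <= v n) ->
  Rabs (l - sum_n u N) <= m - sum_n v N.
Proof.
intros Hu Hv H.
assert (C : is_lim_seq (fun k => Rabs (sum_n u (k + N) - sum_n u N))
              (Rabs (l - sum_n u N))).
{ apply (is_lim_seq_abs _ (Finite (l - sum_n u N))).
  apply is_lim_seq_minus'; [|apply is_lim_seq_const].
  now apply (is_lim_seq_incr_n (sum_n u) N). }
assert (D : is_lim_seq (fun k => sum_n v (k + N) - sum_n v N) (m - sum_n v N)).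
{ apply is_lim_seq_minus'; [|apply is_lim_seq_const].
  now apply (is_lim_seq_incr_n (sum_n v) N). }
refine (is_lim_seq_le _ _ _ _ _ C D).
induction n; cbn [Nat.add].
- rewrite !Rminus_diag, Rabs_R0; lra.
- rewrite !sum_n_RS; specialize (H (S (n + N))).
  replace (sum_n u (n + N) + u (S (n + N)) - sum_n u N) with
    (sum_n u (n + N) - sum_n u N + u (S (n + N))) by ring.
  eapply Rle_trans; [apply Rabs_triang|]; lra.
Qed.

Lemma is_series_abs_le (u v : nat -> R) (l m : R) :
  is_series u l -> is_series v m -> (forall n, Rabs (u n) <= v n) -> Rabs l <= m.
Proof.
intros Hu Hv H.
pose proof (Series_tail_bound u v l m 0 Hu Hv H) as T.
rewrite !sum_n_R0 in T; specialize (H 0%nat).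
replace l with ((l - u 0%nat) + u 0%nat) by ring.
eapply Rle_trans; [apply Rabs_triang|]; lra.
Qed.

Lemma is_lim_seq_sum_n (f : nat -> nat -> R) (g : nat -> R) N :
  (forall n, is_lim_seq (fun j => f j n) (g n)) ->
  is_lim_seq (fun j => sum_n (f j) N) (sum_n g N).
Proof.
intros H; induction N.
- rewrite sum_n_R0; apply is_lim_seq_ext with (2 := H 0%nat).
  intros j; now rewrite sum_n_R0.
- rewrite sum_n_RS.
  apply is_lim_seq_ext with (fun j => sum_n (f j) N + f j (S N)).
  + intros j; now rewrite sum_n_RS.
  + now apply is_lim_seq_plus'.
Qed.

(** Dominated convergence for series: both tails beyond a common [N] are below eps / 3, and the
    finitely many remaining terms converge. *)
Lemma tannery (f : nat -> nat -> R) (g M F : nat -> R) (G : R) :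
  (forall n, is_lim_seq (fun j => f j n) (g n)) ->
  (forall j n, Rabs (f j n) <= M n) -> ex_series M ->
  (forall j, is_series (f j) (F j)) -> is_series g G ->
  is_lim_seq F G.
Proof.
intros Hf HM [m Hm] HF HG.
assert (Hg : forall n, Rabs (g n) <= M n).
{ intros n; refine (is_lim_seq_le _ _ (Rabs (g n)) (M n) (fun j => HM j n) _ _).
  - apply (is_lim_seq_abs _ (Finite (g n))), Hf.
  - apply is_lim_seq_const. }
apply is_lim_seq_spec; intros eps.
assert (He : 0 < eps / 3) by (pose proof (cond_pos eps); lra).
assert (HmS : is_lim_seq (sum_n M) m) by exact Hm.
apply is_lim_seq_spec in HmS.
destruct (HmS (mkposreal _ He)) as [N HN]; specialize (HN N (le_n N)); simpl in HN.
assert (L := is_lim_seq_sum_n f g N Hf); apply is_lim_seq_spec in L.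
destruct (L (mkposreal _ He)) as [J HJ]; exists J; intros j Hj.
specialize (HJ j Hj); simpl in HJ.
pose proof (Series_tail_bound _ _ _ _ N (HF j) Hm (HM j)) as T1.
pose proof (Series_tail_bound _ _ _ _ N HG Hm Hg) as T2.
apply Rabs_lt_between in HN; apply Rabs_lt_between in HJ.
apply Rabs_le_between in T1; apply Rabs_le_between in T2.
apply Rabs_lt_between; lra.
Qed.

(* The Taylor remainders are summable uniformly in [h], so the series may be
   differentiated term by term at [c]. *)
Lemma is_series_derive (f : nat -> R -> R) (f' M : nat -> R) (F : R -> R) (c d l : R) :
  0 < d ->
  (forall h, Rabs h < d -> is_series (fun n => f n (c + h)) (F (c + h))) ->
  (forall h n, Rabs h < d ->
     Rabs (f n (c + h) - f n c - h * f' n) <= M n * h ^ 2) ->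
  ex_series M -> ex_series f' -> is_derive F c l ->
  is_series f' l.
Proof.
intros Hd HF HM [m Hm] [l' Hl'] HD.
replace l with l'; [exact Hl'|].
symmetry; rewrite <- (is_derive_unique _ _ _ HD); apply is_derive_unique.
apply is_derive_Reals; intros eps Heps.
(* The remainder bound at [h = d / 2] forces each [M n] to be non-negative; then m + 1 > 0 and eps /
   (m + 1) is a legitimate radius. *)
assert (Hm0 : 0 <= m).
{ assert (HMp : forall n, Rabs (f' n * 0) <= M n).
  { intros n; rewrite Rmult_0_r, Rabs_R0.
    specialize (HM (d / 2) n); rewrite (Rabs_pos_eq (d / 2)) in HM by lra.
    pose proof (Rabs_pos (f n (c + d / 2) - f n c - d / 2 * f' n)).
    assert (0 < (d / 2) ^ 2) by nra.
    destruct (Rle_or_lt 0 (M n)); nra. }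
  assert (Z : is_series (fun n => f' n * 0) 0).
  { apply series_eq with (1 := series_scal 0 _ _ Hl'); intros; ring. }
  pose proof (is_series_abs_le _ _ _ _ Z Hm HMp) as T.
  now rewrite Rabs_R0 in T. }
assert (Hdelta : 0 < Rmin d (eps / (m + 1))).
{ apply Rmin_pos; auto; apply Rdiv_lt_0_compat; lra. }
exists (mkposreal _ Hdelta); simpl; intros h Hh0 Hh.
assert (H1 : Rabs h < d) by (eapply Rlt_le_trans; [exact Hh|apply Rmin_l]).
assert (H2 : Rabs h < eps / (m + 1)) by (eapply Rlt_le_trans; [exact Hh|apply Rmin_r]).
assert (S0 := HF h H1).
assert (S1 : is_series (fun n => f n c) (F c)).
{ specialize (HF 0); rewrite Rplus_0_r, Rabs_R0 in HF; auto. }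
assert (S2 : is_series (fun n => f n (c + h) - f n c - h * f' n)
               (F (c + h) - F c - h * l')).
{ apply series_eq with
    (1 := series_plus _ _ _ _ (series_plus _ _ _ _ S0 (series_scal (-1) _ _ S1))
            (series_scal (- h) _ _ Hl')); intros; ring. }
assert (S3 : is_series (fun n => M n * h ^ 2) (m * h ^ 2)).
{ apply series_eq with (1 := series_scal (h ^ 2) _ _ Hm); intros; ring. }
pose proof (is_series_abs_le _ _ _ _ S2 S3 (fun n => HM h n H1)) as B.
replace ((F (c + h) - F c) / h - l') with ((F (c + h) - F c - h * l') / h)
  by (field; auto).
unfold Rdiv; rewrite Rabs_mult, Rabs_inv.
assert (Hp : 0 < Rabs h) by (apply Rabs_pos_lt; auto).
apply Rle_lt_trans with (m * Rabs h).
- apply Rmult_le_reg_r with (Rabs h); auto.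
  rewrite Rmult_assoc, Rinv_l by lra.
  replace (m * Rabs h * Rabs h) with (m * h ^ 2); [lra|].
  rewrite <- (pow2_abs h); ring.
- assert (E : eps / (m + 1) * (m + 1) = eps) by (field; lra).
  assert (0 < eps / (m + 1)) by (apply Rdiv_lt_0_compat; lra).
  nra.
Qed.

(** * Fourier expansions *)

(** Lemmas on abstract structures leave equations over a carrier only convertible to [R]; [ring] and
    [field] need [R] itself. *)
Ltac real_eq := match goal with |- ?x = ?y => change (@eq R x y) end.

Lemma sin_half_pos t : 0 < t < 2 * PI -> 0 < sin (t / 2).
Proof. intros H; apply sin_gt_0; lra. Qed.

(** The Dirichlet kernel, by product-to-sum and telescoping. Multiplying by sin (t / 2) instead of
    dividing keeps it valid for every [t]. *)
Lemma cos_sum_closed (t : R) N :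
  2 * sin (t / 2) * sum_n (fun n => cos (idx n * t)) N =
  sin ((idx N + / 2) * t) - sin (t / 2).
Proof.
assert (E : forall x, 2 * sin (t / 2) * cos (x * t) =
              sin ((x + / 2) * t) - sin ((x - / 2) * t)).
{ intros x; replace ((x + / 2) * t) with (x * t + t / 2) by field.
  replace ((x - / 2) * t) with (x * t - t / 2) by field.
  rewrite sin_plus, sin_minus; ring. }
induction N.
- rewrite sum_n_R0, E; f_equal; f_equal; simpl INR; field.
- rewrite sum_n_RS, Rmult_plus_distr_l, IHN, E, idx_S.
  replace (idx N + 1 - / 2) with (idx N + / 2) by field; ring.
Qed.

Lemma sin_sum_closed (t : R) N :
  2 * sin (t / 2) * sum_n (fun n => sin (idx n * t)) N =
  cos (t / 2) - cos ((idx N + / 2) * t).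
Proof.
assert (E : forall x, 2 * sin (t / 2) * sin (x * t) =
              cos ((x - / 2) * t) - cos ((x + / 2) * t)).
{ intros x; replace ((x + / 2) * t) with (x * t + t / 2) by field.
  replace ((x - / 2) * t) with (x * t - t / 2) by field.
  rewrite cos_plus, cos_minus; ring. }
induction N.
- rewrite sum_n_R0, E; f_equal; f_equal; simpl INR; field.
- rewrite sum_n_RS, Rmult_plus_distr_l, IHN, E, idx_S.
  replace (idx N + 1 - / 2) with (idx N + / 2) by field; ring.
Qed.

Lemma Rabs_sin_le1 x : Rabs (sin x) <= 1.
Proof. apply Rabs_le; pose proof (SIN_bound x); lra. Qed.

Lemma Rabs_cos_le1 x : Rabs (cos x) <= 1.
Proof. apply Rabs_le; pose proof (COS_bound x); lra. Qed.

Lemma bounded_of_scaled (s x y z : R) :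
  0 < s -> 2 * s * x = y - z -> Rabs y <= 1 -> Rabs z <= 1 -> Rabs x <= / s.
Proof.
intros Hs E Hy Hz.
apply Rabs_le_between in Hy; apply Rabs_le_between in Hz.
assert (Hi : / s * s = 1) by (field; lra).
assert (0 < / s) by (apply Rinv_0_lt_compat; lra).
apply Rabs_le; split; nra.
Qed.

Lemma cos_sum_bounded (t : R) N : 0 < t < 2 * PI ->
  Rabs (sum_n (fun n => cos (idx n * t)) N) <= / sin (t / 2).
Proof.
intros Ht; apply bounded_of_scaled with (2 := cos_sum_closed t N);
  auto using sin_half_pos, Rabs_sin_le1.
Qed.

Lemma sin_sum_bounded (t : R) N : 0 < t < 2 * PI ->
  Rabs (sum_n (fun n => sin (idx n * t)) N) <= / sin (t / 2).
Proof.
intros Ht; apply bounded_of_scaled with (2 := sin_sum_closed t N);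
  auto using sin_half_pos, Rabs_cos_le1.
Qed.

(** On (0, 2 PI) the function sin (t / 2) increases up to PI and then decreases, so between PI and
    [phi] it is smallest at [phi]. This gives a uniform bound on the kernel's denominator. *)
Lemma sin_half_between (phi t : R) : 0 < phi < 2 * PI ->
  Rmin PI phi <= t <= Rmax PI phi -> sin (phi / 2) <= sin (t / 2) /\ 0 < t < 2 * PI.
Proof.
intros Hp Ht; pose proof PI_RGT_0.
destruct (Rle_or_lt PI phi).
- rewrite Rmin_left, Rmax_right in Ht by lra.
  split; [apply sin_decr_1|]; lra.
- rewrite Rmin_right, Rmax_left in Ht by lra.
  split; [apply sin_incr_1|]; lra.
Qed.

(* Integrating [m(t) sin((N+1/2)t) / (2 sin(t/2))] by parts between [PI] and
   [phi] gains a factor [1/N]; the boundary term vanishes at [PI]. *)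
Lemma dirichlet_kernel_decay (m m' : R -> R) (A phi : R) :
  0 < phi < 2 * PI ->
  (forall t, 0 < t < 2 * PI -> is_derive m t (m' t)) ->
  (forall t, 0 < t < 2 * PI -> Rabs (m t) <= A) ->
  (forall t, 0 < t < 2 * PI -> Rabs (m' t) <= A) ->
  exists K, forall N (p : R -> R),
    (forall t, 0 < t < 2 * PI ->
      is_derive p t (m t * (/ 2 + sum_n (fun n => cos (idx n * t)) N))) ->
    Rabs (p phi - p PI) <= K * / idx N.
Proof.
intros Hphi Hm HA HA'.
set (s := sin (phi / 2)).
assert (Hs : 0 < s) by (apply sin_half_pos; auto).
assert (HA0 : 0 <= A) by (eapply Rle_trans; [apply Rabs_pos|apply (HA phi Hphi)]).
pose proof PI_RGT_0 as Hpi.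
(* The first A / s bounds the boundary term at [phi]; the rest is the bound on the derivative [dq]
   times 2 PI, which exceeds the distance from PI to [phi]. *)
exists ((A * / s + (A * / s + A * / (s ^ 2)) * (2 * PI))); intros N p Hp.
set (x := idx N + / 2).
assert (Hx : 1 <= x) by (unfold x; pose proof (idx_ge1 N); lra).
(* Boundary term of the integration by parts: adding [g] to [p] cancels m(t) sin(x t) / (2 sin(t/2))
   in the derivative and leaves [dq], which carries a factor 1 / x. The mean value theorem for
   [p + g] then replaces the integral. *)
set (g := fun t => m t * cos (x * t) / (2 * x * sin (t / 2))).
set (dq := fun t => cos (x * t) / (2 * x) *
             (m' t * / sin (t / 2) - m t * cos (t / 2) * / (2 * sin (t / 2) ^ 2))).
assert (Dq : forall t, 0 < t < 2 * PI -> is_derive (fun t => p t + g t) t (dq t)).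
{ intros t Ht; pose proof (sin_half_pos t Ht) as Hst.
  assert (Dg : is_derive g t (m' t * cos (x * t) / (2 * x * sin (t / 2))
     + m t * (- x * sin (x * t)) / (2 * x * sin (t / 2))
     - m t * cos (x * t) * (2 * x * (cos (t / 2) / 2)) / (2 * x * sin (t / 2)) ^ 2)).
  { unfold g.
    auto_derive; [repeat split; auto|].
    - exists (m' t); auto.
    - assert (2 * x * sin (t / 2) <> 0) by nra; auto.
    - replace (Derive (fun x => m x) t) with (m' t)
        by (symmetry; apply is_derive_unique, Hm; auto).
      unfold Rdiv; field; lra. }
  pose proof (is_derive_plus _ _ _ _ _ (Hp t Ht) Dg) as D.
  replace (dq t) with (plus (m t * (/ 2 + sum_n (fun n => cos (idx n * t)) N))
    (m' t * cos (x * t) / (2 * x * sin (t / 2))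
     + m t * (- x * sin (x * t)) / (2 * x * sin (t / 2))
     - m t * cos (x * t) * (2 * x * (cos (t / 2) / 2)) / (2 * x * sin (t / 2)) ^ 2)).
  exact D.
  assert (E : sum_n (fun n => cos (idx n * t)) N =
     (sin (x * t) - sin (t / 2)) / (2 * sin (t / 2))).
  { apply Rmult_eq_reg_l with (2 * sin (t / 2)); [|lra].
    rewrite cos_sum_closed; unfold x; field; lra. }
  rewrite E; unfold dq, plus; simpl; field; lra. }
destruct (MVT_gen (fun t => p t + g t) PI phi dq) as [xi [Hxi Exi]].
- intros t Ht; apply Dq, (sin_half_between phi t Hphi); lra.
- intros t Ht; apply continuity_pt_filterlim.
  apply (ex_derive_continuous (fun t => p t + g t)).
  exists (dq t); apply Dq, (sin_half_between phi t Hphi Ht).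
- destruct (sin_half_between phi xi Hphi Hxi) as [Hsx Hxi2]; fold s in Hsx.
  assert (gPI : g PI = 0).
  { unfold g; replace (x * PI) with (PI / 2 + IZR (Z.of_nat (S N)) * PI).
    - rewrite cos_plus, cos_PI2, sin_PI2.
      rewrite (sin_eq_0_1 (IZR (Z.of_nat (S N)) * PI)) by (eexists; reflexivity).
      unfold Rdiv; ring.
    - unfold x; rewrite INR_IZR_INZ; field. }
  assert (Hix : / x <= / idx N).
  { apply Rinv_le_contravar; unfold x; pose proof (idx_ge1 N); lra. }
  assert (Hix0 : 0 < / x) by (apply Rinv_0_lt_compat; lra).
  assert (Hss : / sin (xi / 2) <= / s) by (apply Rinv_le_contravar; lra).
  assert (Hss0 : 0 < / sin (xi / 2)) by (apply Rinv_0_lt_compat; lra).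
  assert (Hs2 : / (2 * sin (xi / 2) ^ 2) <= / s ^ 2) by (apply Rinv_le_contravar; nra).
  assert (Hs20 : 0 < / (2 * sin (xi / 2) ^ 2)) by (apply Rinv_0_lt_compat; nra).
  assert (Bg : Rabs (g phi) <= A * / s * / x).
  { unfold g; fold s; unfold Rdiv; rewrite Rabs_mult, Rabs_inv.
    rewrite (Rabs_pos_eq (2 * x * s)), Rabs_mult by nra.
    replace (A * / s * / x) with (A * / (x * s)) by (field; lra).
    assert (/ (2 * x * s) <= / (x * s)) by (apply Rinv_le_contravar; nra).
    assert (0 < / (2 * x * s)) by (apply Rinv_0_lt_compat; nra).
    pose proof (HA phi Hphi); pose proof (Rabs_cos_le1 (x * phi)).
    pose proof (Rabs_pos (m phi)); pose proof (Rabs_pos (cos (x * phi))).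
    apply Rmult_le_compat; [nra|lra|nra|lra]. }
  assert (Bd : Rabs (dq xi) <= (A * / s + A * / s ^ 2) * / x).
  { unfold dq, Rdiv; rewrite Rabs_mult, Rmult_comm.
    apply Rmult_le_compat; try apply Rabs_pos.
    - unfold Rminus; eapply Rle_trans; [apply Rabs_triang|].
      rewrite Rabs_Ropp, !Rabs_mult.
      rewrite (Rabs_pos_eq (/ sin _)), (Rabs_pos_eq (/ (2 * _))) by lra.
      pose proof (HA xi Hxi2); pose proof (HA' xi Hxi2).
      pose proof (Rabs_cos_le1 (xi / 2)); pose proof (Rabs_pos (cos (xi / 2))).
      pose proof (Rabs_pos (m xi)); pose proof (Rabs_pos (m' xi)).
      apply Rplus_le_compat; apply Rmult_le_compat; try lra; nra.
    - rewrite Rabs_mult, Rabs_inv, (Rabs_pos_eq (2 * x)) by lra.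
      pose proof (Rabs_cos_le1 (x * xi)); pose proof (Rabs_pos (cos (x * xi))).
      assert (/ (2 * x) <= / x) by (apply Rinv_le_contravar; lra).
      assert (0 < / (2 * x)) by (apply Rinv_0_lt_compat; lra).
      nra. }
  replace (p phi - p PI) with (dq xi * (phi - PI) - g phi) by (rewrite gPI in Exi; lra).
  assert (0 < / s) by (apply Rinv_0_lt_compat; lra).
  assert (0 < / s ^ 2) by (apply Rinv_0_lt_compat; nra).
  assert (0 <= A * / s) by nra. assert (0 <= A * / s ^ 2) by nra.
  unfold Rminus at 1; eapply Rle_trans; [apply Rabs_triang|].
  rewrite Rabs_Ropp, Rabs_mult.
  assert (Rabs (phi - PI) <= 2 * PI) by (apply Rabs_le; lra).
  apply Rle_trans with ((A * / s + (A * / s + A * / s ^ 2) * (2 * PI)) * / x).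
  + pose proof (Rmult_le_compat _ _ _ _ (Rabs_pos (dq xi)) (Rabs_pos (phi - PI)) Bd H3).
    lra.
  + apply Rmult_le_compat_l; [nra|lra].
Qed.

(** Common source of the Fourier expansions, with [m] equal to 1, t and exp (lam t): [p N] collects
    primitives of m(t) cos(n t) and of m(t) / 2, so the sum of the primitives at [phi] is known once
    it is known at PI, where the sines vanish. *)
Lemma dirichlet_limit (m m' : R -> R) (A phi : R) (p : nat -> R -> R) :
  0 < phi < 2 * PI ->
  (forall t, 0 < t < 2 * PI -> is_derive m t (m' t)) ->
  (forall t, 0 < t < 2 * PI -> Rabs (m t) <= A) ->
  (forall t, 0 < t < 2 * PI -> Rabs (m' t) <= A) ->
  (forall N t, 0 < t < 2 * PI ->
      is_derive (p N) t (m t * (/ 2 + sum_n (fun n => cos (idx n * t)) N))) ->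
  is_lim_seq (fun N => p N phi - p N PI) 0.
Proof.
intros H1 H2 H3 H4 Hp.
destruct (dirichlet_kernel_decay m m' A phi H1 H2 H3 H4) as [K HK].
apply is_lim_seq_small with (fun N => K * / idx N).
- apply is_lim_seq_scal_0, is_lim_seq_inv_idx.
- intros N; apply HK, Hp.
Qed.

Lemma sin_idx_PI n : sin (idx n * PI) = 0.
Proof. apply sin_eq_0_1; exists (Z.of_nat (S n)); now rewrite INR_IZR_INZ. Qed.

Lemma fourier_sin_inv (phi : R) : 0 < phi < 2 * PI ->
  is_series (fun n => sin (idx n * phi) / idx n) ((PI - phi) / 2).
Proof.
intros Hphi.
set (f := fun n t => sin (idx n * t) / idx n).
assert (D : forall n t, is_derive (f n) t (cos (idx n * t))).
{ intros n t; unfold f; generalize (idx n) (idx_ge1 n); intros x Hx.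
  auto_derive; [lra|field; lra]. }
assert (L : is_lim_seq (fun N =>
   (sum_n (fun n => f n phi) N + phi / 2) - (sum_n (fun n => f n PI) N + PI / 2)) 0).
{ apply (dirichlet_limit (fun _ => 1) (fun _ => 0) 1 phi
     (fun N t => sum_n (fun n => f n t) N + t / 2)); auto.
  - intros; apply @is_derive_const.
  - intros; rewrite Rabs_R1; lra.
  - intros; rewrite Rabs_R0; lra.
  - intros N t _.
    replace (1 * _) with (sum_n (fun n => cos (idx n * t)) N + / 2) by ring.
    apply @is_derive_plus.
    + apply (is_derive_sum_n f N t (fun n => cos (idx n * t))); auto.
    + auto_derive; [trivial|real_eq; field]. }
assert (Z : forall N, sum_n (fun n => f n PI) N = 0).
{ induction N; [rewrite sum_n_R0|rewrite sum_n_RS, IHN]; unfold f;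
    rewrite sin_idx_PI; real_eq; unfold Rdiv; ring. }
change (is_lim_seq (sum_n (fun n => f n phi)) ((PI - phi) / 2)).
apply is_lim_seq_close with (fun _ => (PI - phi) / 2); [apply is_lim_seq_const|].
apply is_lim_seq_ext with (2 := L); intros N; rewrite Z; simpl; lra.
Qed.

Lemma ex_series_cos_inv_sq (phi : R) : ex_series (fun n => cos (idx n * phi) / idx n ^ 2).
Proof.
apply ex_series_abs_le with (2 := ex_series_inv_sq); intros n; pose proof (idx_ge1 n).
assert (0 < / idx n ^ 2) by (apply Rinv_0_lt_compat; nra).
unfold Rdiv; rewrite Rabs_mult, (Rabs_pos_eq (/ _)) by lra.
pose proof (Rabs_cos_le1 (idx n * phi)); nra.
Qed.

(** The primitive of t cos(n t) is cos(n t) / n^2 + t sin(n t) / n; the sine part is removed by the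
    series already summed. The alternating sum at PI remains as an unknown, evaluated later through
    [zeta 2]. *)
Lemma fourier_cos_inv_sq_open (phi : R) : 0 < phi < 2 * PI ->
  is_series (fun n => cos (idx n * phi) / idx n ^ 2)
    (Series (fun n => cos (idx n * PI) / idx n ^ 2) + (PI - phi) ^ 2 / 4).
Proof.
intros Hphi.
set (f := fun n t => cos (idx n * t) / idx n ^ 2 + t * (sin (idx n * t) / idx n)).
assert (D : forall n t, is_derive (f n) t (t * cos (idx n * t))).
{ intros n t; unfold f; generalize (idx n) (idx_ge1 n); intros x Hx.
  auto_derive; [lra|field; lra]. }
assert (L : is_lim_seq (fun N =>
   (sum_n (fun n => f n phi) N + phi ^ 2 / 4) - (sum_n (fun n => f n PI) N + PI ^ 2 / 4)) 0).
{ apply (dirichlet_limit (fun t => t) (fun _ => 1) (2 * PI + 1) phi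
     (fun N t => sum_n (fun n => f n t) N + t ^ 2 / 4)); auto.
  - intros; apply @is_derive_id.
  - intros; rewrite Rabs_pos_eq; lra.
  - intros; rewrite Rabs_pos_eq; pose proof PI_RGT_0; lra.
  - intros N t _.
    replace (t * _) with (sum_n (fun n => t * cos (idx n * t)) N + t / 2).
    + apply @is_derive_plus.
      * apply (is_derive_sum_n f N t (fun n => t * cos (idx n * t))); auto.
      * auto_derive; [trivial|real_eq; field].
    + rewrite sum_n_scal_R; real_eq; field. }
assert (Fpi : is_lim_seq (sum_n (fun n => f n PI))
   (Series (fun n => cos (idx n * PI) / idx n ^ 2))).
{ apply (series_eq _ _ _ _ (Series_correct _ (ex_series_cos_inv_sq PI))); auto.
  intros n; unfold f; rewrite sin_idx_PI; unfold Rdiv; ring. }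
assert (Fphi : is_series (fun n => f n phi)
   (Series (fun n => cos (idx n * PI) / idx n ^ 2) + PI ^ 2 / 4 - phi ^ 2 / 4)).
{ change (is_lim_seq (sum_n (fun n => f n phi))
   (Series (fun n => cos (idx n * PI) / idx n ^ 2) + PI ^ 2 / 4 - phi ^ 2 / 4)).
  apply is_lim_seq_close with
    (fun N => sum_n (fun n => f n PI) N + (PI ^ 2 / 4 - phi ^ 2 / 4)).
  - unfold Rminus; rewrite Rplus_assoc; apply is_lim_seq_plus'; auto.
    apply is_lim_seq_const.
  - apply is_lim_seq_ext with (2 := L); intros; ring. }
apply series_eq with (1 := series_plus _ _ _ _ Fphi
   (series_scal (- phi) _ _ (fourier_sin_inv phi Hphi))).
- intros n; unfold f; ring.
- field.
Qed.

Lemma is_lim_seq_cont (f : R -> R) (u : nat -> R) (x : R) :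
  continuity_pt f x -> is_lim_seq u x -> is_lim_seq (fun n => f (u n)) (f x).
Proof. intros; now apply is_lim_seq_continuous. Qed.

Lemma inv_idx_range j : 0 < / idx j < 2 * PI.
Proof.
pose proof (idx_ge1 j); pose proof PI_RGT_0; pose proof PI2_1.
split; [apply Rinv_0_lt_compat; lra|].
apply Rle_lt_trans with (/ 1); [apply Rinv_le_contravar|]; lra.
Qed.

(** The endpoint 0 lies outside the reach of the Dirichlet kernel; for absolutely summable
    coefficients it is recovered as the limit along phi = 1 / j. *)
Lemma fourier_at_0 (a : nat -> R) (F : R -> R) :
  ex_series (fun n => Rabs (a n)) ->
  (forall phi, 0 < phi < 2 * PI -> is_series (fun n => cos (idx n * phi) * a n) (F phi)) ->
  continuity_pt F 0 -> is_series a (F 0).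
Proof.
intros Ha HF HC.
assert (Sa := Series_correct _ (ex_series_Rabs _ Ha)).
replace (F 0) with (Series a); [exact Sa|].
apply is_lim_seq_R_unique with (fun j => F (/ idx j)).
- apply (tannery (fun j n => cos (idx n * / idx j) * a n) a (fun n => Rabs (a n))); auto.
  + intros n.
    replace (Finite (a n)) with (Finite (cos (idx n * 0) * a n))
      by (rewrite Rmult_0_r, cos_0; f_equal; ring).
    refine (is_lim_seq_cont (fun t => cos (idx n * t) * a n) _ 0 _ is_lim_seq_inv_idx).
    apply continuity_pt_filterlim.
    apply (ex_derive_continuous (fun t => cos (idx n * t) * a n)); auto_derive; trivial.
  + intros j n; rewrite Rabs_mult.
    pose proof (Rabs_cos_le1 (idx n * / idx j)); pose proof (Rabs_pos (a n)); nra.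
  + intros j; apply HF, inv_idx_range.
- apply is_lim_seq_cont; auto using is_lim_seq_inv_idx.
Qed.

(** * Expansions with denominators n^2 + c^2 *)

Lemma sinh_pos x : 0 < x -> 0 < sinh x.
Proof. intros; rewrite <- sinh_0; now apply sinh_lt. Qed.

Lemma cosh_pos x : 0 < cosh x.
Proof. unfold cosh; pose proof (exp_pos x); pose proof (exp_pos (- x)); lra. Qed.

Lemma sq_sum_pos (x y : R) : 0 < y -> 0 < x ^ 2 + y ^ 2.
Proof. intros; nra. Qed.

(** The numerators are those of the primitive of exp(lam t) cos(n t); the exponential is divided out
    at the end. Both signs of [lam] are allowed so that the even and odd parts in [lam] can be
    separated. *)
Lemma fourier_exp (lam phi : R) : lam <> 0 -> 0 < phi < 2 * PI ->
  is_series (fun n => (lam * cos (idx n * phi) + idx n * sin (idx n * phi)) / (idx n ^ 2 + lam ^ 2))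
    (exp (lam * (PI - phi)) *
       (lam * Series (fun n => cos (idx n * PI) / (idx n ^ 2 + lam ^ 2)) + / (2 * lam))
     - / (2 * lam)).
Proof.
intros Hl Hphi.
set (g := fun n t => (lam * cos (idx n * t) + idx n * sin (idx n * t)) / (idx n ^ 2 + lam ^ 2)).
set (f := fun n t => exp (lam * t) * g n t).
assert (D : forall n t, is_derive (f n) t (exp (lam * t) * cos (idx n * t))).
{ intros n t; unfold f, g; generalize (idx n) (idx_ge1 n); intros x Hx.
  auto_derive; [trivial|field; nra]. }
set (A := exp (Rabs lam * (2 * PI)) * (1 + Rabs lam)).
pose proof PI_RGT_0 as Hpi. pose proof (Rabs_pos lam) as Hal.
assert (Hexp : forall t, 0 < t < 2 * PI -> 0 < exp (lam * t) <= exp (Rabs lam * (2 * PI))).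
{ intros t Ht; split; [apply exp_pos|].
  assert (lam * t <= Rabs lam * (2 * PI)).
  { pose proof (Rle_abs lam); nra. }
  destruct H; [left; now apply exp_increasing | right; now rewrite H]. }
assert (L : is_lim_seq (fun N =>
   (sum_n (fun n => f n phi) N + exp (lam * phi) / (2 * lam))
   - (sum_n (fun n => f n PI) N + exp (lam * PI) / (2 * lam))) 0).
{ apply (dirichlet_limit (fun t => exp (lam * t)) (fun t => lam * exp (lam * t)) A phi
     (fun N t => sum_n (fun n => f n t) N + exp (lam * t) / (2 * lam))); auto.
  - intros; auto_derive; [trivial|ring].
  - intros t Ht; specialize (Hexp t Ht); rewrite Rabs_pos_eq by lra; unfold A; nra.
  - intros t Ht; specialize (Hexp t Ht); rewrite Rabs_mult, (Rabs_pos_eq (exp _)) by lra.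
    unfold A; nra.
  - intros N t _.
    replace (exp (lam * t) * _) with
      (sum_n (fun n => exp (lam * t) * cos (idx n * t)) N + exp (lam * t) / 2).
    + apply @is_derive_plus.
      * apply (is_derive_sum_n f N t (fun n => exp (lam * t) * cos (idx n * t))); auto.
      * auto_derive; [trivial|real_eq; field; auto].
    + rewrite sum_n_scal_R; real_eq; field. }
set (C0 := Series (fun n => cos (idx n * PI) / (idx n ^ 2 + lam ^ 2))) in *.
assert (S0 : is_series (fun n => cos (idx n * PI) / (idx n ^ 2 + lam ^ 2)) C0).
{ apply Series_correct; apply ex_series_abs_le with (2 := ex_series_inv_sq); intros n.
  pose proof (idx_ge1 n); assert (0 < lam ^ 2) by nra.
  unfold Rdiv; rewrite Rabs_mult, Rabs_inv, (Rabs_pos_eq (_ + _)) by nra.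
  pose proof (Rabs_cos_le1 (idx n * PI)); pose proof (Rabs_pos (cos (idx n * PI))).
  assert (/ (idx n ^ 2 + lam ^ 2) <= / idx n ^ 2) by (apply Rinv_le_contravar; nra).
  assert (0 < / (idx n ^ 2 + lam ^ 2)) by (apply Rinv_0_lt_compat; nra).
  nra. }
assert (Fpi : is_lim_seq (sum_n (fun n => f n PI)) (exp (lam * PI) * lam * C0)).
{ apply (series_eq _ _ _ _ (series_scal (exp (lam * PI) * lam) _ _ S0)); auto.
  intros n; unfold f, g; rewrite sin_idx_PI; unfold Rdiv; ring. }
assert (Fphi : is_series (fun n => f n phi)
   (exp (lam * PI) * lam * C0 + (exp (lam * PI) / (2 * lam) - exp (lam * phi) / (2 * lam)))).
{ change (is_lim_seq (sum_n (fun n => f n phi))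
   (exp (lam * PI) * lam * C0 + (exp (lam * PI) / (2 * lam) - exp (lam * phi) / (2 * lam)))).
  apply is_lim_seq_close with
    (fun N => sum_n (fun n => f n PI) N
              + (exp (lam * PI) / (2 * lam) - exp (lam * phi) / (2 * lam))).
  - apply is_lim_seq_plus'; auto; apply is_lim_seq_const.
  - apply is_lim_seq_ext with (2 := L); intros; ring. }
assert (E : exp (- (lam * phi)) * exp (lam * phi) = 1)
  by (rewrite <- exp_plus, <- exp_0; f_equal; ring).
assert (E2 : exp (lam * (PI - phi)) = exp (lam * PI) * exp (- (lam * phi)))
  by (rewrite <- exp_plus; f_equal; ring).
apply series_eq with (1 := series_scal (exp (- (lam * phi))) _ _ Fphi).
- intros n; unfold f; rewrite <- Rmult_assoc, E; apply Rmult_1_l.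
- rewrite E2; unfold Rdiv.
  transitivity (exp (lam * PI) * exp (- (lam * phi)) * (lam * C0 + / (2 * lam))
    - exp (- (lam * phi)) * exp (lam * phi) * / (2 * lam)); [ring|rewrite E; ring].
Qed.

Definition P0 (x phi : R) : R := PI * cosh (x * (PI - phi)) / sinh (x * PI) - / x.
Definition P1 (x phi : R) : R := PI * sinh (x * (PI - phi)) / sinh (x * PI).

(** The expansions at c and at -c contain the same sum at PI, which is even in c. Hence their
    difference and their sum share a single unknown [Y]. *)
Lemma fourier_cosh_sinh_const (c : R) : 0 < c -> exists Y, forall phi, 0 < phi < 2 * PI ->
  is_series (fun n => 2 * c * cos (idx n * phi) / (idx n ^ 2 + c ^ 2))
    (Y * cosh (c * (PI - phi)) - / c) /\
  is_series (fun n => 2 * idx n * sin (idx n * phi) / (idx n ^ 2 + c ^ 2))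
    (Y * sinh (c * (PI - phi))).
Proof.
intros Hc.
set (C0 := Series (fun n => cos (idx n * PI) / (idx n ^ 2 + c ^ 2))).
exists (2 * (c * C0 + / (2 * c))); intros phi Hphi.
assert (S1 := fourier_exp c phi ltac:(lra) Hphi).
assert (S2 := fourier_exp (- c) phi ltac:(lra) Hphi).
assert (E : (- c) ^ 2 = c ^ 2) by ring.
rewrite E in S2; fold C0 in S1, S2.
assert (E2 : - c * (PI - phi) = - (c * (PI - phi))) by ring.
rewrite E2 in S2.
split.
- apply series_eq with (1 := series_plus _ _ _ _ S1 (series_scal (-1) _ _ S2)).
  + intros n; pose proof (sq_sum_pos (idx n) c Hc); field; lra.
  + unfold cosh; field; lra.
- apply series_eq with (1 := series_plus _ _ _ _ S1 S2).
  + intros n; pose proof (sq_sum_pos (idx n) c Hc); field; lra.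
  + unfold sinh; field; lra.
Qed.

Lemma Rabs_sin_le x : 0 <= x -> Rabs (sin x) <= x.
Proof.
intros [Hx|<-]; [|rewrite sin_0, Rabs_R0; lra].
apply Rabs_le; split.
- destruct (Rle_or_lt x 1).
  + pose proof PI2_1; assert (0 <= sin x) by (apply sin_ge_0; lra); lra.
  + pose proof (SIN_bound x); lra.
- apply Rlt_le, sin_lt_x; lra.
Qed.

Lemma fourier_cosh_sinh_open (c phi : R) : 0 < c -> 0 < phi < 2 * PI ->
  is_series (fun n => 2 * c * cos (idx n * phi) / (idx n ^ 2 + c ^ 2)) (P0 c phi) /\
  is_series (fun n => 2 * idx n * sin (idx n * phi) / (idx n ^ 2 + c ^ 2)) (P1 c phi).
Proof.
intros Hc Hphi.
destruct (fourier_cosh_sinh_const c Hc) as [Y HY].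
pose proof PI_RGT_0 as Hpi.
assert (Hs : 0 < sinh (c * PI)) by (apply sinh_pos; nra).
(* [Y] is found by comparing the sine series with [sum_n 2 sin (n t) / n = PI - t]
   as [t] tends to [0]. *)
assert (EY : Y * sinh (c * PI) = PI).
{ assert (Hm := Series_correct _ ex_series_inv_sq).
  set (m := Series (fun n => / idx n ^ 2)) in Hm.
  set (F := fun t => Y * sinh (c * (PI - t)) - (PI - t)).
  (* The coefficients 2 n / (n^2 + c^2) and 2 / n differ by 2 c^2 / (n (n^2 + c^2)) in absolute
     value, so |sin (n t)| <= n t still leaves a summable bound, linear in t. *)
  assert (B : forall t, 0 < t < 2 * PI -> Rabs (F t) <= 2 * c ^ 2 * m * t).
  { intros t Ht; destruct (HY t Ht) as [_ S1].
    assert (S2 := series_plus _ _ _ _ S1 (series_scal (-2) _ _ (fourier_sin_inv t Ht))).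
    replace (F t) with (Y * sinh (c * (PI - t)) + -2 * ((PI - t) / 2)) by (unfold F; field).
    replace (2 * c ^ 2 * m * t) with (2 * c ^ 2 * t * m) by ring.
    refine (is_series_abs_le _ _ _ _ S2 (series_scal (2 * c ^ 2 * t) _ _ Hm) _).
    intros n; generalize (idx n) (idx_ge1 n); intros x Hx.
    replace (2 * x * sin (x * t) / (x ^ 2 + c ^ 2) + -2 * (sin (x * t) / x)) with
      (sin (x * t) * (- (2 * c ^ 2 / (x * (x ^ 2 + c ^ 2))))) by (field; nra).
    rewrite Rabs_mult, Rabs_Ropp.
    assert (Hc2 : 0 < c ^ 2) by nra.
    assert (0 < x * (x ^ 2 + c ^ 2)) by (apply Rmult_lt_0_compat; nra).
    rewrite (Rabs_pos_eq (2 * c ^ 2 / _)) by (apply Rlt_le, Rdiv_lt_0_compat; lra).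
    apply Rle_trans with (x * t * (2 * c ^ 2 / (x * (x ^ 2 + c ^ 2)))).
    - apply Rmult_le_compat_r; [apply Rlt_le, Rdiv_lt_0_compat; lra|].
      apply Rabs_sin_le; nra.
    - replace (x * t * (2 * c ^ 2 / (x * (x ^ 2 + c ^ 2)))) with
        (2 * c ^ 2 * t * / (x ^ 2 + c ^ 2)) by (field; nra).
      apply Rmult_le_compat_l; [nra|apply Rinv_le_contravar; nra]. }
  assert (L : is_lim_seq (fun j => F (/ idx j)) (F 0)).
  { apply is_lim_seq_cont; [|apply is_lim_seq_inv_idx].
    apply continuity_pt_filterlim, (ex_derive_continuous F); unfold F; auto_derive; trivial. }
  assert (L0 : is_lim_seq (fun j => F (/ idx j)) 0).
  { apply is_lim_seq_small with (fun j => 2 * c ^ 2 * m * / idx j).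
    - apply is_lim_seq_scal_0, is_lim_seq_inv_idx.
    - intros j; apply B, inv_idx_range. }
  pose proof (is_lim_seq_R_unique _ _ _ L L0) as E; unfold F in E.
  rewrite Rminus_0_r in E; lra. }
destruct (HY phi Hphi) as [S1 S2].
assert (EY' : Y = PI / sinh (c * PI)).
{ apply Rmult_eq_reg_r with (sinh (c * PI)); [|lra].
  rewrite EY; field; lra. }
split.
- apply series_eq with (1 := S1); auto; rewrite EY'; unfold P0; field; lra.
- apply series_eq with (1 := S2); auto; rewrite EY'; unfold P1; field; lra.
Qed.

Lemma fourier_sinh (c phi : R) : 0 < c -> 0 < phi < 2 * PI ->
  is_series (fun n => 2 * idx n * sin (idx n * phi) / (idx n ^ 2 + c ^ 2)) (P1 c phi).
Proof. apply fourier_cosh_sinh_open. Qed.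

Lemma fourier_cosh (c phi : R) : 0 < c -> 0 <= phi < 2 * PI ->
  is_series (fun n => 2 * c * cos (idx n * phi) / (idx n ^ 2 + c ^ 2)) (P0 c phi).
Proof.
intros Hc [[H0|<-] H1]; [now apply fourier_cosh_sinh_open|].
assert (Hs : 0 < sinh (c * PI)) by (apply sinh_pos; pose proof PI_RGT_0; nra).
apply series_eq with (fun n => 2 * c / (idx n ^ 2 + c ^ 2)) (P0 c 0).
- apply (fourier_at_0 _ (P0 c)).
  + apply ex_series_abs_le with (2 := ex_series_scal_R (2 * c) _ ex_series_inv_sq).
    intros n; pose proof (idx_ge1 n).
    assert (/ (idx n ^ 2 + c ^ 2) <= / idx n ^ 2) by (apply Rinv_le_contravar; nra).
    assert (0 < / (idx n ^ 2 + c ^ 2)) by (apply Rinv_0_lt_compat; nra).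
    unfold Rdiv; rewrite Rabs_Rabsolu, Rabs_pos_eq; nra.
  + intros phi Hphi.
    apply series_eq with (1 := proj1 (fourier_cosh_sinh_open c phi Hc Hphi)); auto.
    intros; unfold Rdiv; ring.
  + apply continuity_pt_filterlim, (ex_derive_continuous (P0 c)).
    unfold P0; auto_derive; lra.
- intros n; rewrite Rmult_0_r, cos_0; unfold Rdiv; ring.
- reflexivity.
Qed.

(** * Differentiation of the expansions in the parameter *)

Definition Q0 (x phi : R) : R :=
  / x ^ 2 - PI * (PI * cosh (x * phi) + phi * sinh (x * (PI - phi)) * sinh (x * PI))
              / sinh (x * PI) ^ 2.
Definition Q1 (x phi : R) : R :=
  PI * (PI * sinh (x * phi) - phi * cosh (x * (PI - phi)) * sinh (x * PI))
    / sinh (x * PI) ^ 2.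

Lemma cosh_minus_prod x y : cosh (x - y) = cosh x * cosh y - sinh x * sinh y.
Proof.
unfold cosh, sinh; replace (- (x - y)) with (- x + y) by ring.
unfold Rminus; rewrite !exp_plus; field.
Qed.

Lemma sinh_minus_prod x y : sinh (x - y) = sinh x * cosh y - cosh x * sinh y.
Proof.
unfold cosh, sinh; replace (- (x - y)) with (- x + y) by ring.
unfold Rminus; rewrite !exp_plus; field.
Qed.

Lemma is_derive_P0 (c phi : R) : 0 < c -> is_derive (fun x => P0 x phi) c (Q0 c phi).
Proof.
intros Hc; assert (Hs : 0 < sinh (c * PI)) by (apply sinh_pos; pose proof PI_RGT_0; nra).
unfold P0, Q0; auto_derive; [lra|].
(* The subtraction formula merges the products left by the quotient rule into the single cosh (c
   phi) that the identities contain. *)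
replace (c * phi) with (c * PI - c * (PI - phi)) by ring.
rewrite cosh_minus_prod; field; lra.
Qed.

Lemma is_derive_P1 (c phi : R) : 0 < c -> is_derive (fun x => P1 x phi) c (Q1 c phi).
Proof.
intros Hc; assert (Hs : 0 < sinh (c * PI)) by (apply sinh_pos; pose proof PI_RGT_0; nra).
unfold P1, Q1; auto_derive; [lra|].
replace (c * phi) with (c * PI - c * (PI - phi)) by ring.
rewrite sinh_minus_prod; field; lra.
Qed.

Lemma Rabs_div_le (x y z : R) : 0 < y -> Rabs x <= z * y -> Rabs (x / y) <= z.
Proof.
intros Hy H; unfold Rdiv; rewrite Rabs_mult, Rabs_inv, (Rabs_pos_eq y) by lra.
apply Rmult_le_reg_r with y; auto; rewrite Rmult_assoc, Rinv_l; lra.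
Qed.

Lemma Rabs_mult_le1 (x y z : R) : Rabs x <= 1 -> Rabs y <= z -> Rabs (x * y) <= z.
Proof.
intros Hx Hy; rewrite Rabs_mult; pose proof (Rabs_pos x); pose proof (Rabs_pos y); nra.
Qed.

Lemma fourier_cosh_deriv (c phi : R) : 0 < c -> 0 <= phi < 2 * PI ->
  is_series (fun n => cos (idx n * phi) * (2 * (idx n ^ 2 - c ^ 2) / (idx n ^ 2 + c ^ 2) ^ 2))
    (Q0 c phi).
Proof.
intros Hc Hphi.
apply (is_series_derive
  (fun n x => 2 * x * cos (idx n * phi) / (idx n ^ 2 + x ^ 2)) _
  (fun n => 8 * c * / idx n ^ 2) (fun x => P0 x phi) c c (Q0 c phi)); auto.
- intros h Hh; apply fourier_cosh; auto; apply Rabs_lt_between in Hh; lra.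
- intros h n Hh; apply Rabs_lt_between in Hh.
  generalize (idx n) (idx_ge1 n) (Rabs_cos_le1 (idx n * phi)); intros x Hx Hcos.
  set (y := c + h); assert (Hy : 0 < y < 2 * c) by (unfold y; lra).
  replace h with (y - c) by (unfold y; ring).
  (* The second-order remainder in closed form. Since y < 2 c, its cofactor is at most 4 c (x^2 +
     c^2); with the factor 2 this gives the 8 c of the majorant. *)
  replace (_ - _ - _) with (cos (x * phi) *
    (2 * ((c ^ 2 - x ^ 2) * y - 2 * c * x ^ 2) * (y - c) ^ 2
       / ((x ^ 2 + c ^ 2) ^ 2 * (x ^ 2 + y ^ 2)))) by (field; nra).
  assert (H1 : 0 < x ^ 2 + c ^ 2) by nra. assert (H2 : 1 <= x ^ 2 + y ^ 2) by nra.
  apply Rabs_mult_le1; auto; apply Rabs_div_le; [apply Rmult_lt_0_compat; nra|].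
  assert (Hb : Rabs ((c ^ 2 - x ^ 2) * y - 2 * c * x ^ 2) <= 4 * c * (x ^ 2 + c ^ 2))
    by (apply Rabs_le; split; nra).
  rewrite !Rabs_mult, (Rabs_pos_eq 2), (Rabs_pos_eq (_ ^ 2)) by (try apply pow2_ge_0; lra).
  assert (Hi : 1 <= / x ^ 2 * (x ^ 2 + c ^ 2)).
  { apply Rmult_le_reg_l with (x ^ 2); [nra|].
    rewrite <- Rmult_assoc, Rinv_r by nra; nra. }
  pose proof (pow2_ge_0 (y - c)).
  assert (Hj : 1 <= / x ^ 2 * (x ^ 2 + c ^ 2) * (x ^ 2 + y ^ 2)) by nra.
  apply Rle_trans with (2 * (4 * c * (x ^ 2 + c ^ 2)) * (y - c) ^ 2); [nra|].
  replace (8 * c * / x ^ 2 * (y - c) ^ 2 * ((x ^ 2 + c ^ 2) ^ 2 * (x ^ 2 + y ^ 2))) with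
    (8 * c * (x ^ 2 + c ^ 2) * (y - c) ^ 2 * (/ x ^ 2 * (x ^ 2 + c ^ 2) * (x ^ 2 + y ^ 2)))
    by ring.
  assert (Hk : 0 <= 8 * c * (x ^ 2 + c ^ 2) * (y - c) ^ 2)
    by (apply Rmult_le_pos; [apply Rmult_le_pos|]; lra).
  pose proof (Rmult_le_compat_l _ _ _ Hk Hj); lra.
- apply ex_series_scal_R, ex_series_inv_sq.
- apply ex_series_abs_le with (2 := ex_series_scal_R 2 _ ex_series_inv_sq); intros n.
  generalize (idx n) (idx_ge1 n) (Rabs_cos_le1 (idx n * phi)); intros x Hx Hcos.
  assert (H1 : 0 < x ^ 2 + c ^ 2) by nra.
  apply Rabs_mult_le1; auto; apply Rabs_div_le; [nra|].
  assert (Hi : 1 <= / x ^ 2 * (x ^ 2 + c ^ 2)).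
  { apply Rmult_le_reg_l with (x ^ 2); [nra|].
    rewrite <- Rmult_assoc, Rinv_r by nra; nra. }
  apply Rle_trans with (2 * (x ^ 2 + c ^ 2)); [apply Rabs_le; nra|nra].
- now apply is_derive_P0.
Qed.

Lemma fourier_sinh_deriv (c phi : R) : 0 < c -> 0 < phi < 2 * PI ->
  is_series (fun n => sin (idx n * phi) * (- 4 * idx n * c / (idx n ^ 2 + c ^ 2) ^ 2))
    (Q1 c phi).
Proof.
intros Hc Hphi.
apply (is_series_derive
  (fun n x => 2 * idx n * sin (idx n * phi) / (idx n ^ 2 + x ^ 2)) _
  (fun n => 10 * / idx n ^ 2) (fun x => P1 x phi) c c (Q1 c phi)); auto.
- intros h Hh; apply fourier_sinh; auto; apply Rabs_lt_between in Hh; lra.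
- intros h n Hh; apply Rabs_lt_between in Hh.
  generalize (idx n) (idx_ge1 n) (Rabs_sin_le1 (idx n * phi)); intros x Hx Hsin.
  set (y := c + h); assert (Hy : 0 < y < 2 * c) by (unfold y; lra).
  replace h with (y - c) by (unfold y; ring).
  replace (_ - _ - _) with (sin (x * phi) *
    (2 * x * (c ^ 2 - x ^ 2 + 2 * c * y) * (y - c) ^ 2
       / ((x ^ 2 + c ^ 2) ^ 2 * (x ^ 2 + y ^ 2)))) by (field; nra).
  assert (H1 : 0 < x ^ 2 + c ^ 2) by nra. assert (H2 : x <= x ^ 2 + y ^ 2) by nra.
  apply Rabs_mult_le1; auto; apply Rabs_div_le; [apply Rmult_lt_0_compat; nra|].
  (* Again from y < 2 c; with the factor 2 x of the remainder and x <= x^2 + y^2 it yields the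
     majorant 10 / n^2. *)
  assert (Hb : Rabs (c ^ 2 - x ^ 2 + 2 * c * y) <= 5 * (x ^ 2 + c ^ 2))
    by (apply Rabs_le; split; nra).
  rewrite !Rabs_mult, (Rabs_pos_eq 2), (Rabs_pos_eq x), (Rabs_pos_eq (_ ^ 2))
    by (try apply pow2_ge_0; lra).
  assert (Hi : 1 <= / x ^ 2 * (x ^ 2 + c ^ 2)).
  { apply Rmult_le_reg_l with (x ^ 2); [nra|].
    rewrite <- Rmult_assoc, Rinv_r by nra; nra. }
  pose proof (pow2_ge_0 (y - c)).
  assert (Hj : x <= / x ^ 2 * (x ^ 2 + c ^ 2) * (x ^ 2 + y ^ 2)) by nra.
  apply Rle_trans with (10 * x * (x ^ 2 + c ^ 2) * (y - c) ^ 2).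
  + assert (0 <= x * (y - c) ^ 2) by nra. nra.
  + replace (10 * / x ^ 2 * (y - c) ^ 2 * ((x ^ 2 + c ^ 2) ^ 2 * (x ^ 2 + y ^ 2))) with
    (10 * (x ^ 2 + c ^ 2) * (y - c) ^ 2 * (/ x ^ 2 * (x ^ 2 + c ^ 2) * (x ^ 2 + y ^ 2)))
    by ring.
  assert (Hk : 0 <= 10 * (x ^ 2 + c ^ 2) * (y - c) ^ 2)
    by (apply Rmult_le_pos; [apply Rmult_le_pos|]; lra).
  pose proof (Rmult_le_compat_l _ _ _ Hk Hj); lra.
- apply ex_series_scal_R, ex_series_inv_sq.
- apply ex_series_abs_le with (2 := ex_series_scal_R 2 _ ex_series_inv_sq); intros n.
  generalize (idx n) (idx_ge1 n) (Rabs_sin_le1 (idx n * phi)); intros x Hx Hsin.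
  assert (H1 : 0 < x ^ 2 + c ^ 2) by nra.
  apply Rabs_mult_le1; auto; apply Rabs_div_le; [nra|].
  assert (Hi : 1 <= / x ^ 2 * (x ^ 2 + c ^ 2)).
  { apply Rmult_le_reg_l with (x ^ 2); [nra|].
    rewrite <- Rmult_assoc, Rinv_r by nra; nra. }
  apply Rle_trans with (2 * (x ^ 2 + c ^ 2)); [|nra].
  pose proof (pow2_ge_0 (x - c)); apply Rabs_le; nra.
- now apply is_derive_P1.
Qed.

(** * Splitting by parity, and the value of [zeta 2] *)

Lemma sum_n_odd_even (f : nat -> R) N :
  sum_n (fun k => f (2 * S k - 1)%nat) N
  = sum_n (fun k => f (S k)) (2 * N + 1) - sum_n (fun k => f (2 * S k)%nat) N.
Proof.
induction N.
- rewrite !sum_n_R0; change (2 * 0 + 1)%nat with 1%nat; rewrite sum_n_RS, sum_n_R0.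
  simpl; real_eq; ring.
- rewrite (sum_n_RS _ N), IHN, (sum_n_RS (fun k => f (2 * S k)%nat)).
  replace (2 * S N + 1)%nat with (S (S (2 * N + 1))) by lia.
  rewrite !(sum_n_RS (fun k => f (S k))).
  replace (2 * S (S N) - 1)%nat with (S (S (2 * N + 1))) by lia.
  replace (2 * S (S N))%nat with (S (S (S (2 * N + 1)))) by lia.
  real_eq; ring.
Qed.

(** Argued on partial sums, so conditional convergence suffices: the indices 1 to 2 N + 2 contain
    exactly N + 1 odd and N + 1 even ones. *)
Lemma is_series_odd (f : nat -> R) (l m : R) :
  is_series_from1 f l -> is_series_from1 (fun n => f (2 * n)%nat) m ->
  is_series_from1 (fun n => f (2 * n - 1)%nat) (l - m).
Proof.
intros H1 H2.
change (is_lim_seq (sum_n (fun k => f (2 * S k - 1)%nat)) (l - m)).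
apply is_lim_seq_ext with
  (fun N => sum_n (fun k => f (S k)) (2 * N + 1) - sum_n (fun k => f (2 * S k)%nat) N).
- intros; symmetry; apply sum_n_odd_even.
- apply is_lim_seq_minus'; auto.
  apply (is_lim_seq_subseq (sum_n (fun k => f (S k))) l (fun N => (2 * N + 1)%nat)); auto.
  apply eventually_subseq; intros; lia.
Qed.

Lemma zeta2_series : is_series (fun n => / idx n ^ 2) (zeta 2).
Proof.
apply series_eq with (1 := Series_correct _ ex_series_inv_sq); auto.
unfold zeta; apply Series_ext; intros n; pose proof (idx_ge1 n).
replace 2 with (INR 2) by (simpl; ring); rewrite Rpower_pow by lra; reflexivity.
Qed.

Lemma cos_idx_PI n : cos (idx n * PI) = (-1) ^ S n.
Proof.
induction n.
- simpl INR; rewrite Rmult_1_l, cos_PI; ring.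
- rewrite idx_S, Rmult_plus_distr_r, Rmult_1_l, neg_cos, IHn; simpl; ring.
Qed.

Lemma pow_m1_even n : (-1) ^ (2 * n) = 1.
Proof. rewrite pow_mult; replace ((-1) ^ 2) with 1 by ring; apply pow1. Qed.

Lemma pow_m1_odd n : (-1) ^ (2 * S n - 1) = -1.
Proof.
replace (2 * S n - 1)%nat with (S (2 * n)) by lia.
change ((-1) ^ S (2 * n)) with (-1 * (-1) ^ (2 * n)); rewrite pow_m1_even; ring.
Qed.

(** Even indices contribute zeta(2) / 4 and odd ones 3 zeta(2) / 4 with a minus sign. *)
Lemma alternating_inv_sq : is_series (fun n => cos (idx n * PI) / idx n ^ 2) (- zeta 2 / 2).
Proof.
assert (Z := zeta2_series).
assert (Se : is_series (fun n => / INR (2 * S n) ^ 2) (zeta 2 / 4)).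
{ apply series_eq with (1 := series_scal (/ 4) _ _ Z); [|field].
  intros n; rewrite mult_INR; pose proof (idx_ge1 n); change (INR 2) with 2; field; lra. }
assert (So := is_series_odd (fun n => / INR n ^ 2) _ _ Z Se).
assert (T := Series_correct _ (ex_series_cos_inv_sq PI)).
set (l := Series _) in T.
assert (Te : is_series_from1 (fun n => (-1) ^ (2 * n) / INR (2 * n) ^ 2) (zeta 2 / 4)).
{ apply series_eq with (1 := Se); auto; intros n; rewrite pow_m1_even; unfold Rdiv; ring. }
assert (T' : is_series_from1 (fun n => (-1) ^ n / INR n ^ 2) l).
{ apply series_eq with (1 := T); auto; intros n; now rewrite cos_idx_PI. }
assert (To := is_series_odd _ _ _ T' Te).
assert (E : - (zeta 2 - zeta 2 / 4) = l - zeta 2 / 4).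
{ refine (series_unique _ _ _ _ To).
  apply series_eq with (1 := series_scal (-1) _ _ So); [|ring].
  intros n; rewrite pow_m1_odd; unfold Rdiv; ring. }
apply series_eq with (1 := T); auto; lra.
Qed.

(** The expansion of cos(n phi) / n^2, with its constant now -zeta(2) / 2, is read at phi = 0: this
    gives zeta(2) = -zeta(2) / 2 + PI^2 / 4. *)
Lemma zeta2 : zeta 2 = PI ^ 2 / 6.
Proof.
assert (E := is_series_unique _ _ alternating_inv_sq).
assert (Z : is_series (fun n => / idx n ^ 2) (- zeta 2 / 2 + (PI - 0) ^ 2 / 4)).
{ apply (fourier_at_0 _ (fun phi => - zeta 2 / 2 + (PI - phi) ^ 2 / 4)).
  - apply ex_series_abs_le with (2 := ex_series_inv_sq).
    intros n; rewrite Rabs_Rabsolu, Rabs_pos_eq; [lra|].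
    apply Rlt_le, Rinv_0_lt_compat; pose proof (idx_ge1 n); nra.
  - intros phi Hphi; apply series_eq with (1 := fourier_cos_inv_sq_open phi Hphi); auto.
    now rewrite E.
  - apply continuity_pt_filterlim.
    apply (ex_derive_continuous (fun phi => - zeta 2 / 2 + (PI - phi) ^ 2 / 4)).
    auto_derive; trivial. }
pose proof (series_unique _ _ _ zeta2_series Z); lra.
Qed.

Lemma fourier_cos_inv_sq (phi : R) : 0 <= phi < 2 * PI ->
  is_series (fun n => cos (idx n * phi) / idx n ^ 2) (zeta 2 - PI * phi / 2 + phi ^ 2 / 4).
Proof.
intros [[H0|<-] H1].
- apply series_eq with (1 := fourier_cos_inv_sq_open phi (conj H0 H1)); auto.
  rewrite (is_series_unique _ _ alternating_inv_sq), zeta2; field.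
- apply series_eq with (1 := zeta2_series).
  + intros n; rewrite Rmult_0_r, cos_0; unfold Rdiv; ring.
  + field.
Qed.

(** * Exchange of summations *)

(** Abel summation. Monotonicity of [u] is replaced by a [g] dominating both [u] and its increments,
    as the kernels change sign. The two boundary terms and the telescoping sum of increments add up
    to 2 W g(K). *)
Lemma dirichlet_tail (w u g : nat -> R) (W : R) K L :
  (forall N, Rabs (sum_n w N) <= W) ->
  (forall k, Rabs (u k) <= g k) ->
  (forall k, Rabs (u k - u (S k)) <= g k - g (S k)) ->
  Rabs (sum_n (fun k => w k * u k) (L + K) - sum_n (fun k => w k * u k) K) <= 2 * W * g K.
Proof.
intros HW Hu Hd.
assert (HW0 : 0 <= W) by (eapply Rle_trans; [apply Rabs_pos|apply (HW 0%nat)]).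
set (s := sum_n (fun k => w k * u k)).
assert (I : Rabs (s (L + K)%nat - s K - sum_n w (L + K) * u (L + K)%nat + sum_n w K * u K)
            <= W * (g K - g (L + K)%nat)).
{ induction L; cbn [Nat.add].
  - match goal with |- Rabs ?x <= _ => replace x with 0 by (real_eq; ring) end.
    rewrite Rabs_R0; lra.
  - match goal with |- Rabs ?x <= _ => replace x with
      ((s (L + K)%nat - s K - sum_n w (L + K) * u (L + K)%nat + sum_n w K * u K)
       + sum_n w (L + K) * (u (L + K)%nat - u (S (L + K)))) end.
    + eapply Rle_trans; [apply Rabs_triang|]; rewrite (Rabs_mult (sum_n w (L + K))).
      pose proof (Rmult_le_compat _ _ _ _ (Rabs_pos _) (Rabs_pos _) (HW (L + K)%nat)
                    (Hd (L + K)%nat)); lra.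
    + unfold s; rewrite !sum_n_RS; real_eq; ring. }
pose proof (Rmult_le_compat _ _ _ _ (Rabs_pos _) (Rabs_pos _) (HW (L + K)%nat)
              (Hu (L + K)%nat)) as H1.
pose proof (Rmult_le_compat _ _ _ _ (Rabs_pos _) (Rabs_pos _) (HW K) (Hu K)) as H2.
rewrite <- Rabs_mult in H1, H2.
apply Rabs_le_between in I; apply Rabs_le_between in H1; apply Rabs_le_between in H2.
apply Rabs_le; lra.
Qed.

Lemma dirichlet_remainder (w u g : nat -> R) (W B : R) K :
  (forall N, Rabs (sum_n w N) <= W) ->
  (forall k, Rabs (u k) <= g k) ->
  (forall k, Rabs (u k - u (S k)) <= g k - g (S k)) ->
  is_series (fun k => w k * u k) B ->
  Rabs (B - sum_n (fun k => w k * u k) K) <= 2 * W * g K.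
Proof.
intros HW Hu Hd HB.
refine (is_lim_seq_le _ _ (Rabs (B - sum_n (fun k => w k * u k) K)) (2 * W * g K)
          (fun L => dirichlet_tail w u g W K L HW Hu Hd) _ (is_lim_seq_const _)).
apply (is_lim_seq_abs _ (Finite (B - sum_n (fun k => w k * u k) K))).
apply is_lim_seq_minus'; [|apply is_lim_seq_const].
now apply (is_lim_seq_incr_n (sum_n (fun k => w k * u k)) K).
Qed.

Lemma dirichlet_bound (w u g : nat -> R) (W B : R) :
  (forall N, Rabs (sum_n w N) <= W) ->
  (forall k, Rabs (u k) <= g k) ->
  (forall k, Rabs (u k - u (S k)) <= g k - g (S k)) ->
  is_series (fun k => w k * u k) B ->
  Rabs B <= 3 * W * g 0%nat.
Proof.
intros HW Hu Hd HB.
pose proof (dirichlet_remainder w u g W B 0 HW Hu Hd HB) as H.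
specialize (HW 0%nat); specialize (Hu 0%nat); rewrite sum_n_R0 in HW, H.
pose proof (Rmult_le_compat _ _ _ _ (Rabs_pos _) (Rabs_pos _) HW Hu) as H1.
rewrite <- Rabs_mult in H1.
apply Rabs_le_between in H; apply Rabs_le_between in H1; apply Rabs_le; lra.
Qed.

Lemma series_inv_sq_shift (c : R) : 0 < c ->
  exists m, is_series (fun n => / (idx n + c) ^ 2) m /\ m <= / c.
Proof.
intros Hc.
destruct (ex_series_nonneg (fun n => / (idx n + c) ^ 2) (/ c)) as [m Hm].
- intros n; pose proof (idx_ge1 n); apply Rlt_le, Rinv_0_lt_compat; nra.
- intros N; now apply sum_n_inv_sq_bound.
- exists m; split; auto.
  refine (is_lim_seq_le _ _ m (/ c) (fun N => sum_n_inv_sq_bound c N Hc) Hm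
            (is_lim_seq_const _)).
Qed.

(* The [w]-summation is truncated at [K]; by Dirichlet's test the error in the
   [n]-th term is [O(1/(n + c K)^2)], hence [O(1/c K)] after summing over [n]. *)
Lemma exchange (w e c : nat -> R) (u : nat -> R -> R) (A B : nat -> R) (W E C : R) :
  (forall N, Rabs (sum_n w N) <= W) -> (forall n, Rabs (e n) <= E) ->
  (forall k, 0 < c k) -> (forall k, c k <= c (S k)) -> is_lim_seq (fun k => / c k) 0 ->
  (forall n t, 0 < t -> Rabs (u n t) <= C * / (idx n + t) ^ 2) ->
  (forall n s t, 0 < s <= t ->
     Rabs (u n s - u n t) <= C * (/ (idx n + s) ^ 2 - / (idx n + t) ^ 2)) ->
  (forall k, is_series (fun n => e n * u n (c k)) (A k)) ->
  (forall n, is_series (fun k => w k * u n (c k)) (B n)) ->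
  exists l, is_series (fun k => w k * A k) l /\ is_series (fun n => e n * B n) l.
Proof.
intros HW HE Hc Hmon Hlim Hu Hd HA HB.
assert (HE0 : 0 <= E) by (eapply Rle_trans; [apply Rabs_pos|apply (HE 0%nat)]).
assert (HC : 0 <= C).
{ specialize (Hu 0%nat 1 Rlt_0_1); pose proof (Rabs_pos (u 0%nat 1)).
  assert (0 < / (idx 0 + 1) ^ 2) by (apply Rinv_0_lt_compat; simpl; lra).
  nra. }
set (g := fun n k => C * / (idx n + c k) ^ 2).
assert (Hu' : forall n k, Rabs (u n (c k)) <= g n k) by (intros; apply Hu, Hc).
assert (Hd' : forall n k, Rabs (u n (c k) - u n (c (S k))) <= g n k - g n (S k)).
{ intros n k; unfold g; rewrite <- Rmult_minus_distr_l; apply Hd; auto. }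
(* [dirichlet_bound] gives |B n| <= 3 W C / (n + c 0)^2, so the series over n converges
   absolutely. *)
destruct (ex_series_abs_le (fun n => e n * B n)
   (fun n => E * 3 * W * C * / (idx n + c 0%nat) ^ 2)) as [l Hl].
{ intros n; rewrite Rabs_mult.
  pose proof (dirichlet_bound w _ (g n) W (B n) HW (Hu' n) (Hd' n) (HB n)) as H.
  pose proof (Rmult_le_compat _ _ _ _ (Rabs_pos _) (Rabs_pos _) (HE n) H).
  unfold g in *; lra. }
{ apply ex_series_scal_R; destruct (series_inv_sq_shift (c 0%nat) (Hc 0%nat)) as [m [Hm _]].
  now exists m. }
exists l; split; auto.
change (is_lim_seq (sum_n (fun k => w k * A k)) l).
apply is_lim_seq_close with (fun _ => l); [apply is_lim_seq_const|].
apply is_lim_seq_small with (fun K => E * (2 * W) * C * / c K).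
{ now apply is_lim_seq_scal_0. }
intros K.
assert (F : is_series (fun n => e n * sum_n (fun k => w k * u n (c k)) K)
              (sum_n (fun k => w k * A k) K)).
{ clear - HA; induction K.
  - rewrite sum_n_R0; apply series_eq with (1 := series_scal (w 0%nat) _ _ (HA 0%nat)); auto.
    intros n; rewrite sum_n_R0; ring.
  - rewrite sum_n_RS.
    apply series_eq with
      (1 := series_plus _ _ _ _ IHK (series_scal (w (S K)) _ _ (HA (S K)))); auto.
    intros n; rewrite sum_n_RS; ring. }
destruct (series_inv_sq_shift (c K) (Hc K)) as [m [Hm Hmle]].
assert (D : is_series (fun n => e n * (sum_n (fun k => w k * u n (c k)) K - B n))
              (sum_n (fun k => w k * A k) K - l)).
{ apply series_eq with (1 := series_plus _ _ _ _ F (series_scal (-1) _ _ Hl)).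
  - intros; ring.
  - ring. }
assert (HW0 : 0 <= W) by (eapply Rle_trans; [apply Rabs_pos|apply (HW 0%nat)]).
apply Rle_trans with (E * (2 * W) * C * m).
- refine (is_series_abs_le _ _ _ _ D (series_scal (E * (2 * W) * C) _ _ Hm) _).
  intros n; rewrite Rabs_mult, Rabs_minus_sym.
  pose proof (dirichlet_remainder w _ (g n) W (B n) K HW (Hu' n) (Hd' n) (HB n)) as H.
  pose proof (Rmult_le_compat _ _ _ _ (Rabs_pos _) (Rabs_pos _) (HE n) H) as H1.
  eapply Rle_trans; [exact H1|]; unfold g.
  right; ring.
- apply Rmult_le_compat_l; auto.
  apply Rmult_le_pos; nra.
Qed.

(** The boundary term is bounded times null. [reciprocity_P] uses both directions: one to reach
    differences that decay quadratically, the other to return after the exchange. *)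
Lemma is_series_abel (e u : nat -> R) (E l : R) :
  (forall N, Rabs (sum_n e N) <= E) -> is_lim_seq u 0 ->
  is_series (fun n => e n * u n) l <->
  is_series (fun n => sum_n e n * (u n - u (S n))) l.
Proof.
intros HE Hu.
assert (Id : forall N, sum_n (fun n => e n * u n) N =
  sum_n e N * u (S N) + sum_n (fun n => sum_n e n * (u n - u (S n))) N).
{ induction N.
  - rewrite !sum_n_R0; real_eq; ring.
  - rewrite (sum_n_RS (fun n => e n * u n)), IHN.
    rewrite (sum_n_RS (fun n => sum_n e n * (u n - u (S n)))).
    rewrite (sum_n_RS e); real_eq; ring. }
assert (Z : is_lim_seq (fun N => sum_n e N * u (S N)) 0).
{ apply is_lim_seq_small with (fun N => E * Rabs (u (S N))).
  - apply is_lim_seq_scal_0.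
    apply (is_lim_seq_incr_1 (fun N => Rabs (u N))).
    apply -> is_lim_seq_abs_0; exact Hu.
  - intros N; rewrite Rabs_mult; apply Rmult_le_compat_r; auto using Rabs_pos. }
split; intros H.
- change (is_lim_seq (sum_n (fun n => sum_n e n * (u n - u (S n)))) l).
  apply is_lim_seq_close with (sum_n (fun n => e n * u n)); [exact H|].
  apply is_lim_seq_ext with (fun N => -1 * (sum_n e N * u (S N))).
  + intros N; rewrite Id; real_eq; ring.
  + now apply is_lim_seq_scal_0.
- change (is_lim_seq (sum_n (fun n => e n * u n)) l).
  apply is_lim_seq_close with (sum_n (fun n => sum_n e n * (u n - u (S n)))); [exact H|].
  apply is_lim_seq_ext with (2 := Z); intros N; real_eq; specialize (Id N); lra.
Qed.

(** * Size and variation of the kernels *)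

Lemma variation_le (u u' : R -> R) (x C : R) : 0 < x ->
  (forall t, 0 < t -> is_derive u t (u' t)) ->
  (forall t, 0 < t -> Rabs (u' t) <= 2 * C / (x + t) ^ 3) ->
  forall s t, 0 < s <= t -> Rabs (u s - u t) <= C * (/ (x + s) ^ 2 - / (x + t) ^ 2).
Proof.
intros Hx Hu Hb s t Hst.
(* 2 C / (x + t)^3 is minus the derivative of C / (x + t)^2, so adding either [u] or its opposite to
   the latter gives a non-increasing function. *)
assert (M : forall sg, sg = 1 \/ sg = -1 ->
   C * / (x + t) ^ 2 + sg * u t <= C * / (x + s) ^ 2 + sg * u s).
{ intros sg Hsg.
  set (f := fun y => C * / (x + y) ^ 2 + sg * u y).
  set (f' := fun y => - (2 * C / (x + y) ^ 3) + sg * u' y).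
  assert (D : forall y, 0 < y -> is_derive f y (f' y)).
  { intros y Hy; unfold f, f'.
    apply (is_derive_plus (fun y => C * / (x + y) ^ 2) (fun y => sg * u y)).
    - auto_derive; [nra|real_eq; field; lra].
    - apply is_derive_scal, Hu, Hy. }
  destruct (MVT_gen f s t f') as [xi [Hxi Exi]].
  - intros y Hy; rewrite Rmin_left in Hy by lra; apply D; lra.
  - intros y Hy; rewrite Rmin_left in Hy by lra.
    apply continuity_pt_filterlim, (ex_derive_continuous f); exists (f' y); apply D; lra.
  - rewrite Rmin_left in Hxi by lra.
    assert (f' xi <= 0).
    { unfold f'; specialize (Hb xi ltac:(lra)); apply Rabs_le_between in Hb.
      destruct Hsg; subst sg; lra. }
    fold (f s) (f t); nra. }
pose proof (M 1 (or_introl eq_refl)); pose proof (M (-1) (or_intror eq_refl)).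
apply Rabs_le; lra.
Qed.

Lemma inv_sq_add_le (x y : R) : 0 < x -> 0 < y -> / (x ^ 2 + y ^ 2) <= 2 * / (x + y) ^ 2.
Proof.
intros Hx Hy; replace (2 * / (x + y) ^ 2) with (/ ((x + y) ^ 2 / 2)) by (field; lra).
pose proof (pow2_ge_0 (x - y)); apply Rinv_le_contravar; nra.
Qed.

(** The kernel is twice the real part of (x + i y)^-3, whose modulus is comparable to (x + y)^-3.
    The 24, reused in all kernel bounds, is 6 from the numerator times 4 from (x + y)^4 <= 4 (x^2 +
    y^2)^2. *)
Lemma cubic_kernel_le (x y : R) : 0 < x -> 0 < y ->
  Rabs (2 * x * (x ^ 2 - 3 * y ^ 2) / (x ^ 2 + y ^ 2) ^ 3) <= 24 / (x + y) ^ 3.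
Proof.
intros Hx Hy.
assert (Hq : 0 < x ^ 2 + y ^ 2) by nra.
apply Rabs_div_le; [now apply pow_lt|].
pose proof (inv_sq_add_le x y Hx Hy) as Hi.
assert (Hs : 0 < (x + y) ^ 2) by nra.
assert (Hq2 : (x + y) ^ 2 <= 2 * (x ^ 2 + y ^ 2)) by (pose proof (pow2_ge_0 (x - y)); nra).
assert (Hq4 : (x + y) ^ 2 * (x + y) ^ 2 <= 4 * (x ^ 2 + y ^ 2) ^ 2) by nra.
apply Rle_trans with (6 * x * (x ^ 2 + y ^ 2)); [apply Rabs_le; split; nra|].
replace (24 / (x + y) ^ 3 * (x ^ 2 + y ^ 2) ^ 3) with
  (6 * (x + y) * (x ^ 2 + y ^ 2) * (4 * (x ^ 2 + y ^ 2) ^ 2 / ((x + y) ^ 2 * (x + y) ^ 2)))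
  by (field; lra).
assert (1 <= 4 * (x ^ 2 + y ^ 2) ^ 2 / ((x + y) ^ 2 * (x + y) ^ 2)).
{ apply Rmult_le_reg_r with ((x + y) ^ 2 * (x + y) ^ 2); [nra|].
  unfold Rdiv; rewrite Rmult_assoc, Rinv_l by nra; lra. }
assert (0 < 6 * x * (x ^ 2 + y ^ 2)) by nra.
assert (0 < 6 * y * (x ^ 2 + y ^ 2)) by nra.
nra.
Qed.

Lemma Rabs_diff_unit_le (f f' : R -> R) (x K : R) :
  (forall y, x <= y <= x + 1 -> is_derive f y (f' y)) ->
  (forall y, x <= y <= x + 1 -> Rabs (f' y) <= K) ->
  Rabs (f x - f (x + 1)) <= K.
Proof.
intros D B.
destruct (MVT_gen f x (x + 1) f') as [xi [Hxi E]].
- intros y Hy; rewrite Rmin_left, Rmax_right in Hy by lra; apply D; lra.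
- intros y Hy; rewrite Rmin_left, Rmax_right in Hy by lra.
  apply continuity_pt_filterlim, (ex_derive_continuous f); exists (f' y); apply D; lra.
- rewrite Rmin_left, Rmax_right in Hxi by lra.
  rewrite Rabs_minus_sym, E, Rabs_mult, (Rabs_pos_eq (x + 1 - x)) by lra.
  specialize (B xi Hxi); lra.
Qed.

Lemma inv_cube_le (x y t : R) : 0 < x -> x <= y -> 0 < t ->
  24 / (t + y) ^ 3 <= 24 / (x + t) ^ 3.
Proof.
intros Hx Hy Ht; apply Rmult_le_compat_l; [lra|].
apply Rinv_le_contravar; [apply pow_lt; lra|apply pow_incr; lra].
Qed.

Lemma quadratic_kernel_le (x y z : R) : 0 < x -> 0 < y ->
  Rabs z <= 2 * (x ^ 2 + y ^ 2) -> Rabs (z / (x ^ 2 + y ^ 2) ^ 2) <= 24 * / (x + y) ^ 2.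
Proof.
intros Hx Hy Hz.
assert (Hq : 0 < x ^ 2 + y ^ 2) by nra.
pose proof (inv_sq_add_le x y Hx Hy) as Hi.
assert (0 < / (x + y) ^ 2) by (apply Rinv_0_lt_compat; nra).
apply Rle_trans with (2 * / (x ^ 2 + y ^ 2)); [|lra].
apply Rabs_div_le; [now apply pow_lt|].
replace (2 * / (x ^ 2 + y ^ 2) * (x ^ 2 + y ^ 2) ^ 2) with (2 * (x ^ 2 + y ^ 2))
  by (field; lra); lra.
Qed.

Lemma even_kernel_le (x t : R) : 0 < x -> 0 < t ->
  Rabs (2 * (x ^ 2 - t ^ 2) / (x ^ 2 + t ^ 2) ^ 2) <= 24 * / (x + t) ^ 2.
Proof. intros; apply quadratic_kernel_le; auto; apply Rabs_le; nra. Qed.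

Lemma odd_kernel_le (x t : R) : 0 < x -> 0 < t ->
  Rabs (- 4 * x * t / (x ^ 2 + t ^ 2) ^ 2) <= 24 * / (x + t) ^ 2.
Proof.
intros; apply quadratic_kernel_le; auto.
pose proof (pow2_ge_0 (x - t)); apply Rabs_le; nra.
Qed.

Lemma even_kernel_variation (x s t : R) : 0 < x -> 0 < s <= t ->
  Rabs (2 * (x ^ 2 - s ^ 2) / (x ^ 2 + s ^ 2) ^ 2 - 2 * (x ^ 2 - t ^ 2) / (x ^ 2 + t ^ 2) ^ 2)
  <= 24 * (/ (x + s) ^ 2 - / (x + t) ^ 2).
Proof.
intros Hx Hst.
apply (variation_le (fun t => 2 * (x ^ 2 - t ^ 2) / (x ^ 2 + t ^ 2) ^ 2)
  (fun t => 2 * (2 * t * (t ^ 2 - 3 * x ^ 2) / (t ^ 2 + x ^ 2) ^ 3))); auto; intros y Hy.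
- assert (0 < x ^ 2 + y ^ 2) by nra.
  auto_derive; [nra|field; nra].
- rewrite Rabs_mult, (Rabs_pos_eq 2) by lra.
  pose proof (cubic_kernel_le y x Hy Hx).
  pose proof (inv_cube_le x x y Hx (Rle_refl _) Hy).
  unfold Rdiv in *; lra.
Qed.

Lemma odd_kernel_variation (x s t : R) : 0 < x -> 0 < s <= t ->
  Rabs (- 4 * x * s / (x ^ 2 + s ^ 2) ^ 2 - - 4 * x * t / (x ^ 2 + t ^ 2) ^ 2)
  <= 24 * (/ (x + s) ^ 2 - / (x + t) ^ 2).
Proof.
intros Hx Hst.
apply (variation_le (fun t => - 4 * x * t / (x ^ 2 + t ^ 2) ^ 2)
  (fun t => - 2 * (2 * x * (x ^ 2 - 3 * t ^ 2) / (x ^ 2 + t ^ 2) ^ 3))); auto; intros y Hy.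
- assert (0 < x ^ 2 + y ^ 2) by nra.
  auto_derive; [nra|field; nra].
- rewrite Rabs_mult, (Rabs_left (-2)) by lra.
  pose proof (cubic_kernel_le x y Hx Hy); unfold Rdiv in *; lra.
Qed.

(** A unit difference in x behaves like a derivative in x, which improves the decay from (x + t)^-1
    to the (x + t)^-2 that [exchange] requires. *)
Lemma step_kernel_le (x t : R) : 0 < x -> 0 < t ->
  Rabs (2 * x / (x ^ 2 + t ^ 2) - 2 * (x + 1) / ((x + 1) ^ 2 + t ^ 2)) <= 24 * / (x + t) ^ 2.
Proof.
intros Hx Ht.
apply (Rabs_diff_unit_le (fun y => 2 * y / (y ^ 2 + t ^ 2))
         (fun y => - (2 * (y ^ 2 - t ^ 2)) / (y ^ 2 + t ^ 2) ^ 2)); intros y Hy.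
- assert (0 < y ^ 2 + t ^ 2) by nra; auto_derive; [nra|field; nra].
- apply Rle_trans with (24 * / (y + t) ^ 2).
  + apply quadratic_kernel_le; try lra; apply Rabs_le; nra.
  + apply Rmult_le_compat_l; [lra|apply Rinv_le_contravar; nra].
Qed.

(** The t-derivative is a unit difference of odd kernels, hence bounded by a mixed second
    derivative: the cubic kernel with its arguments swapped. *)
Lemma step_kernel_variation (x s t : R) : 0 < x -> 0 < s <= t ->
  Rabs ((2 * x / (x ^ 2 + s ^ 2) - 2 * (x + 1) / ((x + 1) ^ 2 + s ^ 2))
        - (2 * x / (x ^ 2 + t ^ 2) - 2 * (x + 1) / ((x + 1) ^ 2 + t ^ 2)))
  <= 24 * (/ (x + s) ^ 2 - / (x + t) ^ 2).
Proof.
intros Hx Hst.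
apply (variation_le
  (fun t => 2 * x / (x ^ 2 + t ^ 2) - 2 * (x + 1) / ((x + 1) ^ 2 + t ^ 2))
  (fun t => - 4 * x * t / (x ^ 2 + t ^ 2) ^ 2
            - - 4 * (x + 1) * t / ((x + 1) ^ 2 + t ^ 2) ^ 2)); auto; intros z Hz.
- assert (0 < x ^ 2 + z ^ 2) by nra; assert (0 < (x + 1) ^ 2 + z ^ 2) by nra.
  auto_derive; [repeat split; nra|field; nra].
- apply (Rabs_diff_unit_le (fun y => - 4 * y * z / (y ^ 2 + z ^ 2) ^ 2)
    (fun y => - 2 * (2 * z * (z ^ 2 - 3 * y ^ 2) / (z ^ 2 + y ^ 2) ^ 3))); intros y Hy.
  + assert (0 < y ^ 2 + z ^ 2) by nra; auto_derive; [nra|field; nra].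
  + rewrite Rabs_mult, (Rabs_left (-2)) by lra.
    pose proof (cubic_kernel_le z y Hz ltac:(lra)).
    pose proof (inv_cube_le x y z Hx ltac:(lra) Hz).
    unfold Rdiv in *; lra.
Qed.

Lemma idx_div_pos (r : R) k : 0 < r -> 0 < idx k / r.
Proof. intros; apply Rdiv_lt_0_compat; auto; pose proof (idx_ge1 k); lra. Qed.

Lemma idx_div_mon (r : R) k : 0 < r -> idx k / r <= idx (S k) / r.
Proof.
intros; apply Rmult_le_compat_r; [apply Rlt_le, Rinv_0_lt_compat; auto|rewrite idx_S; lra].
Qed.

Lemma is_lim_inv_idx_div (r : R) : 0 < r -> is_lim_seq (fun k => / (idx k / r)) 0.
Proof.
intros Hr; apply is_lim_seq_ext with (fun k => r * / idx k).
- intros k; pose proof (idx_ge1 k); field; lra.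
- apply is_lim_seq_scal_0, is_lim_seq_inv_idx.
Qed.

(** * Reciprocity formulas *)

(** The kernel 2 (n^2 - t^2) / (n^2 + t^2)^2 is antisymmetric and homogeneous of degree -2, so at t
    = k / r it is -r^2 times the same kernel at (k, r n): the sum over k is again a [Q0]. *)
Lemma reciprocity_Q0 (r phi psi : R) : 0 < r -> 0 < psi < 2 * PI -> 0 <= phi < 2 * PI ->
  exists l, is_series (fun k => cos (idx k * psi) * Q0 (idx k / r) phi) l /\
    is_series (fun n => cos (idx n * phi) * (- r ^ 2 * Q0 (r * idx n) psi)) l.
Proof.
intros Hr Hpsi Hphi.
apply (exchange (fun k => cos (idx k * psi)) (fun n => cos (idx n * phi))
  (fun k => idx k / r) (fun n t => 2 * (idx n ^ 2 - t ^ 2) / (idx n ^ 2 + t ^ 2) ^ 2)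
  _ _ (/ sin (psi / 2)) 1 24).
- intros N; now apply cos_sum_bounded.
- intros; apply Rabs_cos_le1.
- intros; now apply idx_div_pos.
- intros; now apply idx_div_mon.
- now apply is_lim_inv_idx_div.
- intros n t Ht; pose proof (idx_ge1 n); apply even_kernel_le; lra.
- intros n s t Hst; pose proof (idx_ge1 n); apply even_kernel_variation; lra.
- intros k; apply fourier_cosh_deriv; auto; now apply idx_div_pos.
- intros n; pose proof (idx_ge1 n).
  apply series_eq with (1 := series_scal (- r ^ 2) _ _
    (fourier_cosh_deriv (r * idx n) psi ltac:(nra) ltac:(lra))); auto.
  intros k; pose proof (idx_ge1 k); field.
  assert (0 < idx k ^ 2 + (r * idx n) ^ 2) by nra.
  repeat split; nra.
Qed.

(** As for [Q0], but this kernel is symmetric, whence the opposite sign. *)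
Lemma reciprocity_Q1 (r phi psi : R) : 0 < r -> 0 < psi < 2 * PI -> 0 < phi < 2 * PI ->
  exists l, is_series (fun k => sin (idx k * psi) * Q1 (idx k / r) phi) l /\
    is_series (fun n => sin (idx n * phi) * (r ^ 2 * Q1 (r * idx n) psi)) l.
Proof.
intros Hr Hpsi Hphi.
apply (exchange (fun k => sin (idx k * psi)) (fun n => sin (idx n * phi))
  (fun k => idx k / r) (fun n t => - 4 * idx n * t / (idx n ^ 2 + t ^ 2) ^ 2)
  _ _ (/ sin (psi / 2)) 1 24).
- intros N; now apply sin_sum_bounded.
- intros; apply Rabs_sin_le1.
- intros; now apply idx_div_pos.
- intros; now apply idx_div_mon.
- now apply is_lim_inv_idx_div.
- intros n t Ht; pose proof (idx_ge1 n); apply odd_kernel_le; lra.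
- intros n s t Hst; pose proof (idx_ge1 n); apply odd_kernel_variation; lra.
- intros k; apply fourier_sinh_deriv; auto; now apply idx_div_pos.
- intros n; pose proof (idx_ge1 n).
  apply series_eq with (1 := series_scal (r ^ 2) _ _
    (fourier_sinh_deriv (r * idx n) psi ltac:(nra) Hpsi)); auto.
  intros k; pose proof (idx_ge1 k); field.
  assert (0 < idx k ^ 2 + (r * idx n) ^ 2) by nra.
  repeat split; nra.
Qed.

Lemma series_P0_dual (r psi : R) n : 0 < r -> 0 < psi < 2 * PI ->
  is_series (fun k => cos (idx k * psi) * (2 * idx n / (idx n ^ 2 + (idx k / r) ^ 2)))
    (r * P0 (r * idx n) psi).
Proof.
intros Hr Hpsi; pose proof (idx_ge1 n).
apply series_eq with (1 := series_scal r _ _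
  (fourier_cosh (r * idx n) psi ltac:(nra) ltac:(lra))); auto.
intros k; pose proof (idx_ge1 k); field.
assert (0 < idx k ^ 2 + (r * idx n) ^ 2) by nra.
repeat split; nra.
Qed.

(** Needed for the boundary term of the Abel summation. The k-series has positive decreasing
    coefficients, the first at most 2 / n, so Dirichlet's bound applies with [u] as its own
    majorant. *)
Lemma is_lim_P0 (r psi : R) : 0 < r -> 0 < psi < 2 * PI ->
  is_lim_seq (fun n => r * P0 (r * idx n) psi) 0.
Proof.
intros Hr Hpsi.
apply is_lim_seq_small with (fun n => 6 * / sin (psi / 2) * / idx n).
{ apply is_lim_seq_scal_0, is_lim_seq_inv_idx. }
intros n; pose proof (idx_ge1 n).
set (u := fun k => 2 * idx n / (idx n ^ 2 + (idx k / r) ^ 2)).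
assert (Hden : forall k, 0 < idx n ^ 2 + (idx k / r) ^ 2).
{ intros k; pose proof (pow2_ge_0 (idx k / r)); nra. }
assert (Hu0 : forall k, 0 < u k) by (intros k; apply Rdiv_lt_0_compat; auto; lra).
assert (Hmon : forall k, u (S k) <= u k).
{ intros k; apply Rmult_le_compat_l; [lra|]; apply Rinv_le_contravar; auto.
  apply Rplus_le_compat_l, pow_incr; split; [|now apply idx_div_mon].
  apply Rlt_le; now apply idx_div_pos. }
apply Rle_trans with (3 * / sin (psi / 2) * u 0%nat).
- apply (dirichlet_bound (fun k => cos (idx k * psi)) u u).
  + intros N; now apply cos_sum_bounded.
  + intros k; rewrite Rabs_pos_eq; [lra|apply Rlt_le; auto].
  + intros k; rewrite Rabs_pos_eq; [lra|specialize (Hmon k); lra].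
  + now apply series_P0_dual.
- replace (6 * / sin (psi / 2) * / idx n) with (3 * / sin (psi / 2) * (2 * idx n / idx n ^ 2)).
  + apply Rmult_le_compat_l.
    * assert (0 < / sin (psi / 2)) by (now apply Rinv_0_lt_compat, sin_half_pos); lra.
    * apply Rmult_le_compat_l; [lra|]; apply Rinv_le_contravar; [nra|].
      pose proof (pow2_ge_0 (idx 0 / r)); lra.
  + pose proof (sin_half_pos psi Hpsi); field; lra.
Qed.

Lemma is_lim_linear_over_square (c : R) : 0 < c ->
  is_lim_seq (fun n => 2 * idx n / (idx n ^ 2 + c ^ 2)) 0.
Proof.
intros Hc; apply is_lim_seq_small with (fun n => 2 * / idx n).
{ apply is_lim_seq_scal_0, is_lim_seq_inv_idx. }
intros n; pose proof (idx_ge1 n).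
replace (2 * / idx n) with (2 * idx n / idx n ^ 2) by (field; lra).
rewrite Rabs_pos_eq by (apply Rlt_le, Rdiv_lt_0_compat; nra).
apply Rmult_le_compat_l; [lra|]; apply Rinv_le_contravar; nra.
Qed.

(** The exchange is run with the partial sums of sin (n phi) as weights, bounded because 0 < phi < 2
    PI, against the step kernels. Swapping the roles of n and k turns a [P1] into a [P0], as 2 n /
    (n^2 + (k / r)^2) = r * 2 (r n) / (k^2 + (r n)^2). *)
Lemma reciprocity_P (r phi psi : R) : 0 < r -> 0 < psi < 2 * PI -> 0 < phi < 2 * PI ->
  exists l, is_series (fun k => cos (idx k * psi) * P1 (idx k / r) phi) l /\
    is_series (fun n => sin (idx n * phi) * (r * P0 (r * idx n) psi)) l.
Proof.
intros Hr Hpsi Hphi.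
assert (HE := fun N => sin_sum_bounded phi N Hphi).
destruct (exchange (fun k => cos (idx k * psi))
  (fun n => sum_n (fun j => sin (idx j * phi)) n)
  (fun k => idx k / r)
  (fun n t => 2 * idx n / (idx n ^ 2 + t ^ 2) - 2 * (idx n + 1) / ((idx n + 1) ^ 2 + t ^ 2))
  (fun k => P1 (idx k / r) phi)
  (fun n => r * P0 (r * idx n) psi - r * P0 (r * idx (S n)) psi)
  (/ sin (psi / 2)) (/ sin (phi / 2)) 24) as [l [H1 H2]]; auto.
- intros N; now apply cos_sum_bounded.
- intros; now apply idx_div_pos.
- intros; now apply idx_div_mon.
- now apply is_lim_inv_idx_div.
- intros n t Ht; pose proof (idx_ge1 n); apply step_kernel_le; lra.
- intros n s t Hst; pose proof (idx_ge1 n); apply step_kernel_variation; lra.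
- intros k; pose proof (idx_div_pos r k Hr) as Hk.
  apply series_eq with (fun n => sum_n (fun j => sin (idx j * phi)) n *
    (2 * idx n / (idx n ^ 2 + (idx k / r) ^ 2)
     - 2 * idx (S n) / (idx (S n) ^ 2 + (idx k / r) ^ 2))) (P1 (idx k / r) phi); auto.
  apply (is_series_abel (fun n => sin (idx n * phi))
      (fun n => 2 * idx n / (idx n ^ 2 + (idx k / r) ^ 2)) (/ sin (phi / 2))); auto.
  + now apply is_lim_linear_over_square.
  + apply series_eq with (1 := fourier_sinh _ _ Hk Hphi); auto.
    intros; unfold Rdiv; ring.
- intros n.
  apply series_eq with (1 := series_plus _ _ _ _ (series_P0_dual r psi n Hr Hpsi)
    (series_scal (-1) _ _ (series_P0_dual r psi (S n) Hr Hpsi))); [|ring].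
  intros k; rewrite (idx_S n); ring.
- exists l; split; auto.
  apply (is_series_abel (fun n => sin (idx n * phi)) (fun n => r * P0 (r * idx n) psi)
    (/ sin (phi / 2))); auto using is_lim_P0.
Qed.

(** * The four identities *)

Lemma cosh_neg x : cosh (- x) = cosh x.
Proof. unfold cosh; rewrite Ropp_involutive; field. Qed.

Lemma sinh_neg x : sinh (- x) = - sinh x.
Proof. unfold sinh; rewrite Ropp_involutive; field. Qed.

Lemma sinh_neg_sq x : sinh (- x) ^ 2 = sinh x ^ 2.
Proof. rewrite sinh_neg; ring. Qed.

Lemma sinh_neq_0 x : x <> 0 -> sinh x <> 0.
Proof.
intros Hx; destruct (Rdichotomy _ _ Hx) as [H|H].
- pose proof (sinh_pos (- x)) as P; rewrite sinh_neg in P; lra.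
- pose proof (sinh_pos x); lra.
Qed.

Lemma sinh_double x : sinh (2 * x) = 2 * sinh x * cosh x.
Proof.
unfold sinh, cosh; replace (2 * x) with (x + x) by ring.
rewrite Ropp_plus_distr, !exp_plus; field.
Qed.

Lemma cosh_sq x : cosh x ^ 2 = 1 + sinh x ^ 2.
Proof.
unfold sinh, cosh; assert (E : exp x * exp (- x) = 1) by
  (rewrite <- exp_plus, <- exp_0; f_equal; ring).
replace (((exp x + exp (- x)) / 2) ^ 2) with
  (exp x * exp (- x) + ((exp x - exp (- x)) / 2) ^ 2) by field.
now rewrite E.
Qed.

Lemma inv_cosh_sq x : x <> 0 -> / cosh x ^ 2 = / sinh x ^ 2 - 4 * / sinh (2 * x) ^ 2.
Proof.
intros Hx; rewrite sinh_double; pose proof (sinh_neq_0 x Hx); pose proof (cosh_pos x).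
transitivity ((cosh x ^ 2 - 1) / (sinh x ^ 2 * cosh x ^ 2)); [|field; lra].
rewrite (cosh_sq x) at 2; field; lra.
Qed.

Lemma sin_even_half_PI n : sin (INR (2 * n) * (PI / 2)) = 0.
Proof.
apply sin_eq_0_1; exists (Z.of_nat n); rewrite mult_INR, <- INR_IZR_INZ; change (INR 2) with 2; field.
Qed.

Lemma sin_odd_half_PI n : sin (INR (2 * S n - 1) * (PI / 2)) = - (-1) ^ S n.
Proof.
replace (INR (2 * S n - 1)) with (2 * INR n + 1).
- replace ((2 * INR n + 1) * (PI / 2)) with (INR n * PI + PI / 2) by field.
  rewrite sin_plus, cos_PI2, sin_PI2, Rmult_0_r, Rplus_0_l, Rmult_1_r.
  destruct n; [simpl; rewrite Rmult_0_l, cos_0; ring|rewrite cos_idx_PI; simpl; ring].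
- rewrite minus_INR, mult_INR, (S_INR n) by lia; change (INR 2) with 2; change (INR 1) with 1.
  ring.
Qed.

Lemma INR_odd n : INR (2 * S n - 1) = 2 * idx n - 1.
Proof.
rewrite minus_INR, mult_INR by lia; change (INR 2) with 2; change (INR 1) with 1; ring.
Qed.

Lemma sinh_idx_neq_0 (x : R) n : 0 < x -> sinh (x * idx n * PI) <> 0.
Proof.
intros Hx; pose proof (idx_ge1 n); pose proof PI_RGT_0.
assert (0 < x * idx n) by nra; apply sinh_neq_0; nra.
Qed.

(** At psi = PI, [Q0] and [P0] reduce to the summands of [S3] and [S2] up to their poles. The poles
    contribute zeta(2) - PI phi / 2 + phi^2 / 4 and phi (PI - phi) / 2; the terms linear in phi
    cancel, and the sum of cos (k PI) / c_k^2 supplies -r^2 zeta(2) / 2. *)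
Lemma even_core (r phi : R) : 0 < r -> 0 <= phi < 2 * PI ->
  exists S1 S2 S3,
    is_series (fun k => cosh (idx k / r * phi) / sinh (idx k / r * PI) ^ 2 * (-1) ^ S k) S1 /\
    is_series (fun n => sin (idx n * phi) / sinh (r * idx n * PI)) S2 /\
    is_series (fun n => cos (idx n * phi) * cosh (r * idx n * PI) / sinh (r * idx n * PI) ^ 2) S3 /\
    PI ^ 2 * S1 + PI * r * phi * S2 + r ^ 2 * PI ^ 2 * S3 + phi ^ 2 / 4
      + zeta 2 / 2 * (r ^ 2 - 2) = 0.
Proof.
intros Hr Hphi; pose proof PI_RGT_0 as Hpi.
assert (Hpsi : 0 < PI < 2 * PI) by lra.
destruct (reciprocity_Q0 r phi PI Hr Hpsi Hphi) as [l1 [K1 N1]].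
assert (N1' : is_series
  (fun n => cos (idx n * phi) * cosh (r * idx n * PI) / sinh (r * idx n * PI) ^ 2)
  ((l1 + (zeta 2 - PI * phi / 2 + phi ^ 2 / 4)) / (r ^ 2 * PI ^ 2))).
{ apply series_eq with (1 := series_scal (/ (r ^ 2 * PI ^ 2)) _ _
     (series_plus _ _ _ _ N1 (fourier_cos_inv_sq phi Hphi))); [|field; lra].
  intros n; pose proof (idx_ge1 n); pose proof (sinh_idx_neq_0 r n Hr).
  unfold Q0; rewrite Rminus_diag, Rmult_0_r, sinh_0; field; lra. }
(* Only phi times the [P1] sum enters, so at phi = 0, where [reciprocity_P] does not apply, both
   series are termwise zero; they are obtained as 0 times a series known to converge. *)
assert (H2 : exists S2, is_series (fun n => sin (idx n * phi) / sinh (r * idx n * PI)) S2 /\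
   is_series (fun k => cos (idx k * PI) * (phi * P1 (idx k / r) phi))
     (phi * (r * PI * S2 - (PI - phi) / 2))).
{ destruct Hphi as [[H0|<-] H1].
  - destruct (reciprocity_P r phi PI Hr Hpsi (conj H0 H1)) as [l2 [K2 N2]].
    exists ((l2 + (PI - phi) / 2) / (r * PI)); split.
    + apply series_eq with (1 := series_scal (/ (r * PI)) _ _
        (series_plus _ _ _ _ N2 (fourier_sin_inv phi (conj H0 H1)))); [|field; lra].
      intros n; pose proof (idx_ge1 n); pose proof (sinh_idx_neq_0 r n Hr).
      unfold P0; rewrite Rminus_diag, Rmult_0_r, cosh_0; field; lra.
    + apply series_eq with (1 := series_scal phi _ _ K2).
      * intros; ring.
      * field; lra.
  - exists 0; split.
    + apply series_eq with (1 := series_scal 0 _ _ N1); [|ring].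
      intros; rewrite (Rmult_0_r (idx n)), sin_0; unfold Rdiv; ring.
    + apply series_eq with (1 := series_scal 0 _ _ N1); intros; ring. }
destruct H2 as [S2 [N2 K2]].
(* [S1] is the weighted sum of 1 / c_k^2 - Q0 - phi P1, divided by PI^2. *)
exists (((- r ^ 2 * zeta 2 / 2) - l1 - phi * (r * PI * S2 - (PI - phi) / 2)) / PI ^ 2), S2.
eexists; split; [|split; [exact N2|split; [exact N1'|field; lra]]].
apply series_eq with (1 := series_scal (/ PI ^ 2) _ _
  (series_plus _ _ _ _ (series_scal (r ^ 2) _ _ alternating_inv_sq)
    (series_scal (-1) _ _ (series_plus _ _ _ _ K1 K2)))); [|field; lra].
intros k; pose proof (idx_ge1 k); pose proof (idx_div_pos r k Hr).
rewrite <- cos_idx_PI; unfold Q0, P1.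
assert (sinh (idx k / r * PI) <> 0) by (apply sinh_neq_0; nra).
field; lra.
Qed.

(** Provides [S2] of the next lemma at phi = 0, where the reciprocity formulas do not reach. From
    exp(y/2) >= 1 + y/2 one gets cosh y >= y^2 / 8. *)
Lemma series_inv_cosh (r : R) : 0 < r ->
  exists l, is_series (fun n => 1 / cosh (r * idx n * PI)) l.
Proof.
intros Hr.
apply ex_series_abs_le with (2 := ex_series_scal_R (8 / (r * PI) ^ 2) _ ex_series_inv_sq).
intros n; generalize (idx n) (idx_ge1 n); intros x Hx; pose proof PI_RGT_0.
assert (Hrp : 0 < r * PI) by nra.
apply Rabs_div_le; [apply cosh_pos|]; rewrite Rabs_R1.
set (y := r * x * PI); assert (Hy : 0 < y) by (unfold y; nra).
assert (Hc : y ^ 2 / 8 <= cosh y).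
{ unfold cosh; pose proof (exp_pos (- y)).
  replace (exp y) with (exp (y / 2) * exp (y / 2)) by (rewrite <- exp_plus; f_equal; field).
  pose proof (exp_ineq1_le (y / 2)); nra. }
replace (8 / (r * PI) ^ 2 * / x ^ 2) with (8 / y ^ 2) by (unfold y; field; lra).
apply Rle_trans with (8 / y ^ 2 * (y ^ 2 / 8)); [right; field; lra|].
apply Rmult_le_compat_l; auto; apply Rlt_le, Rdiv_lt_0_compat; nra.
Qed.

Lemma P1_half_PI (x : R) : 0 < x -> P1 (2 * x) (PI / 2) = PI / (2 * cosh (x * PI)).
Proof.
intros Hx; unfold P1; pose proof PI_RGT_0; pose proof (cosh_pos (x * PI)).
assert (sinh (x * PI) <> 0) by (apply sinh_neq_0; nra).
replace (2 * x * (PI - PI / 2)) with (x * PI) by field.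
replace (2 * x * PI) with (2 * (x * PI)) by ring; rewrite sinh_double; field; lra.
Qed.

Lemma Q1_half_PI (x : R) : 0 < x ->
  Q1 (2 * x) (PI / 2) = - PI ^ 2 * sinh (x * PI) / (4 * cosh (x * PI) ^ 2).
Proof.
intros Hx; unfold Q1; pose proof PI_RGT_0; pose proof (cosh_pos (x * PI)).
assert (sinh (x * PI) <> 0) by (apply sinh_neq_0; nra).
replace (2 * x * (PI - PI / 2)) with (x * PI) by field.
replace (2 * x * (PI / 2)) with (x * PI) by field.
replace (2 * x * PI) with (2 * (x * PI)) by ring; rewrite sinh_double.
transitivity (PI ^ 2 * sinh (x * PI) * (1 - cosh (x * PI) ^ 2) /
  (4 * sinh (x * PI) ^ 2 * cosh (x * PI) ^ 2)); [field; lra|].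
rewrite (cosh_sq (x * PI)) at 1; field; lra.
Qed.

(** Here PI^2 sinh (c phi) / sinh (c PI)^2 = Q1 + phi (P0 + 1 / c). With c_k = k / (2 r) and weights
    sin (k PI / 2), even k drop out; the pole contributes 2 r phi times PI / 4, the last term of the
    identity. *)
Lemma odd_core (r phi : R) : 0 < r -> 0 <= phi < 2 * PI ->
  exists S1 S2 S3,
    is_series (fun k => sinh ((2 * idx k - 1) / (2 * r) * phi)
      / sinh ((2 * idx k - 1) / (2 * r) * PI) ^ 2 * (-1) ^ S k) S1 /\
    is_series (fun n => cos (idx n * phi) / cosh (r * idx n * PI)) S2 /\
    is_series (fun n => sin (idx n * phi) * sinh (r * idx n * PI) / cosh (r * idx n * PI) ^ 2) S3 /\
    PI ^ 2 * S1 + PI * r * phi * S2 - r ^ 2 * PI ^ 2 * S3 + r * phi * PI / 2 = 0.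
Proof.
intros Hr [[H0|<-] H1]; pose proof PI_RGT_0 as Hpi.
2:{ destruct (series_inv_cosh r Hr) as [l Hl]; exists 0, l, 0; repeat split.
  - apply series_eq with (1 := series_scal 0 _ _ Hl); [|ring].
    intros; rewrite (Rmult_0_r (_ / _)), sinh_0; unfold Rdiv; ring.
  - apply series_eq with (1 := Hl); auto; intros; now rewrite Rmult_0_r, cos_0.
  - apply series_eq with (1 := series_scal 0 _ _ Hl); [|ring].
    intros; rewrite (Rmult_0_r (idx n)), sin_0; unfold Rdiv; ring.
  - field. }
assert (Hphi : 0 < phi < 2 * PI) by lra.
assert (Hpsi : 0 < PI / 2 < 2 * PI) by lra.
assert (H2r : 0 < 2 * r) by lra.
destruct (reciprocity_Q1 (2 * r) phi (PI / 2) H2r Hpsi Hphi) as [l1 [K1 N1]].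
(* Used with the inverse ratio and the two angles exchanged: the sum over c_k now involves [P0] with
   sine weights, its dual [P1] with cosine weights. *)
destruct (reciprocity_P (/ (2 * r)) (PI / 2) phi (Rinv_0_lt_compat _ H2r) Hphi Hpsi)
  as [l2 [N2 K2]].
assert (N1' : is_series
  (fun n => sin (idx n * phi) * sinh (r * idx n * PI) / cosh (r * idx n * PI) ^ 2)
  (- l1 / (r ^ 2 * PI ^ 2))).
{ apply series_eq with (1 := series_scal (- / (r ^ 2 * PI ^ 2)) _ _ N1); [|field; lra].
  intros n; pose proof (idx_ge1 n); pose proof (cosh_pos (r * idx n * PI)).
  replace (2 * r * idx n) with (2 * (r * idx n)) by ring; rewrite Q1_half_PI by nra; field; lra. }
assert (N2' : is_series (fun n => cos (idx n * phi) / cosh (r * idx n * PI)) (2 * l2 / PI)).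
{ apply series_eq with (1 := series_scal (2 / PI) _ _ N2); [|field; lra].
  intros n; pose proof (idx_ge1 n); pose proof (cosh_pos (r * idx n * PI)).
  replace (idx n / / (2 * r)) with (2 * (r * idx n)) by (field; lra).
  rewrite P1_half_PI by nra; field; lra. }
(* [f] runs over all k; at odd k = 2 n - 1 its weight is -(-1)^n, hence the opposite sign in the
   witness for [S1]. *)
set (f := fun k => sin (INR k * (PI / 2)) *
   (sinh (INR k / (2 * r) * phi) / sinh (INR k / (2 * r) * PI) ^ 2)).
assert (T : is_series_from1 f ((l1 + phi * (2 * r * l2 + r * PI / 2)) / PI ^ 2)).
{ apply series_eq with (1 := series_scal (/ PI ^ 2) _ _ (series_plus _ _ _ _ K1
    (series_scal (phi * (2 * r)) _ _ (series_plus _ _ _ _ K2 (fourier_sin_inv _ Hpsi)))));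
    [|field; lra].
  intros k; pose proof (idx_ge1 k); pose proof (idx_div_pos _ k H2r); unfold f, Q1.
  replace (/ (2 * r) * idx k) with (idx k / (2 * r)) by (unfold Rdiv; ring).
  unfold P0.
  assert (sinh (idx k / (2 * r) * PI) <> 0) by (apply sinh_neq_0; nra).
  field; lra. }
assert (T0 : is_series_from1 (fun k => f (2 * k)%nat) 0).
{ apply series_eq with (1 := series_scal 0 _ _ N1); [|ring].
  intros k; unfold f; rewrite sin_even_half_PI; ring. }
exists (- ((l1 + phi * (2 * r * l2 + r * PI / 2)) / PI ^ 2)), (2 * l2 / PI).
eexists; split; [|split; [exact N2'|split; [exact N1'|field; lra]]].
apply series_eq with (1 := series_scal (-1) _ _ (is_series_odd _ _ _ T T0)); [|ring].
intros k; unfold f; rewrite sin_odd_half_PI, INR_odd; unfold Rdiv; ring.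
Qed.

(** Kept as a predicate of the parameters, since it is transported under sign changes and
    instantiated at both b and 2 b. *)
Definition identity_integer_sinh (a b theta : R) : Prop :=
  exists S1 S2 S3 : R,
     is_series_from1 (fun n =>
       cosh (theta * INR n / a) / sinh (b * INR n * PI / a) ^ 2 * (-1) ^ n) S1
     /\ is_series_from1 (fun n =>
       sin (INR n * theta / b) / sinh (a * INR n * PI / b)) S2
     /\ is_series_from1 (fun n =>
       cos (INR n * theta / b) * cosh (a * INR n * PI / b)
         / sinh (a * INR n * PI / b) ^ 2) S3
     /\ b ^ 2 * PI ^ 2 * S1 + theta * PI * a * S2 + a ^ 2 * PI ^ 2 * S3
        + theta ^ 2 / 4 + zeta 2 / 2 * (a ^ 2 - 2 * b ^ 2) = 0.

Definition identity_half_sinh (a b theta : R) : Prop :=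
  exists S1 S2 S3 : R,
     is_series_from1 (fun n =>
       sinh ((2 * INR n - 1) * theta / (2 * a))
         / sinh ((2 * INR n - 1) * b * PI / (2 * a)) ^ 2 * (-1) ^ n) S1
     /\ is_series_from1 (fun n =>
       cos (INR n * theta / b) / cosh (INR n * PI * a / b)) S2
     /\ is_series_from1 (fun n =>
       sin (INR n * theta / b) * sinh (INR n * PI * a / b)
         / cosh (INR n * PI * a / b) ^ 2) S3
     /\ b ^ 2 * PI ^ 2 * S1 + a * PI * theta * S2 - a ^ 2 * PI ^ 2 * S3
        + a * theta * PI / 2 = 0.

(** Sign changes of a and theta reduce to a > 0 and theta >= 0, the range in which a / b and theta /
    b are admissible for the core lemmas. *)
Lemma sign_wlog (P : R -> R -> R -> Prop) :
  (forall a b theta, a <> 0 -> 0 < b -> P (- a) b theta -> P a b theta) ->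
  (forall a b theta, a <> 0 -> 0 < b -> P a b (- theta) -> P a b theta) ->
  (forall a b theta, 0 < a -> 0 < b -> 0 <= theta < 2 * b * PI -> P a b theta) ->
  forall a b theta, Rabs theta < 2 * b * PI -> a <> 0 -> 0 < b -> P a b theta.
Proof.
intros Ha Ht H a b theta Hth Ha0 Hb; apply Rabs_lt_between in Hth.
assert (K : forall theta, - (2 * b * PI) < theta < 2 * b * PI -> 0 <= theta -> P a b theta).
{ intros t Ht1 Ht0; destruct (Rdichotomy _ _ Ha0).
  - apply Ha; auto; apply H; lra.
  - apply H; lra. }
destruct (Rle_or_lt 0 theta); [apply K; lra|apply Ht; auto; apply K; lra].
Qed.

Lemma angle_range (b theta : R) : 0 < b -> 0 <= theta < 2 * b * PI ->
  0 <= theta / b < 2 * PI.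
Proof.
intros Hb Ht; assert (E : theta / b * b = theta) by (field; lra).
split; [apply Rdiv_le_0_compat; lra|].
apply Rmult_lt_reg_r with b; lra.
Qed.

Lemma integer_sinh_identity (a b theta : R) :
  Rabs theta < 2 * b * PI -> a <> 0 -> 0 < b -> identity_integer_sinh a b theta.
Proof.
revert a b theta; apply sign_wlog.
- intros a b t Ha Hb (S1 & S2 & S3 & H1 & H2 & H3 & H).
  exists S1, (- S2), S3; split; [|split; [|split]].
  + apply series_eq with (1 := H1); auto; intros n.
    replace (t * idx n / - a) with (- (t * idx n / a)) by (field; auto).
    replace (b * idx n * PI / - a) with (- (b * idx n * PI / a)) by (field; auto).
    now rewrite cosh_neg, sinh_neg_sq.
  + apply series_eq with (1 := series_scal (-1) _ _ H2); [intros n|ring].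
    replace (- a * idx n * PI / b) with (- (a * idx n * PI / b)) by (field; lra).
    rewrite sinh_neg; unfold Rdiv; rewrite Rinv_opp; ring.
  + apply series_eq with (1 := H3); auto; intros n.
    replace (- a * idx n * PI / b) with (- (a * idx n * PI / b)) by (field; lra).
    now rewrite cosh_neg, sinh_neg_sq.
  + rewrite <- H; ring.
- intros a b t Ha Hb (S1 & S2 & S3 & H1 & H2 & H3 & H).
  exists S1, (- S2), S3; split; [|split; [|split]].
  + apply series_eq with (1 := H1); auto; intros n.
    replace (- t * idx n / a) with (- (t * idx n / a)) by (field; auto).
    now rewrite cosh_neg.
  + apply series_eq with (1 := series_scal (-1) _ _ H2); [intros n|ring].
    replace (idx n * - t / b) with (- (idx n * t / b)) by (field; lra).
    rewrite sin_neg; unfold Rdiv; ring.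
  + apply series_eq with (1 := H3); auto; intros n.
    replace (idx n * - t / b) with (- (idx n * t / b)) by (field; lra).
    now rewrite cos_neg.
  + rewrite <- H; field.
- intros a b t Ha Hb Ht.
  destruct (even_core (a / b) (t / b) (Rdiv_lt_0_compat _ _ Ha Hb) (angle_range _ _ Hb Ht))
    as (S1 & S2 & S3 & H1 & H2 & H3 & H).
  exists S1, S2, S3; split; [|split; [|split]].
  + apply series_eq with (1 := H1); auto; intros n.
    replace (idx n / (a / b) * (t / b)) with (t * idx n / a) by (field; lra).
    now replace (idx n / (a / b) * PI) with (b * idx n * PI / a) by (field; lra).
  + apply series_eq with (1 := H2); auto; intros n.
    replace (idx n * (t / b)) with (idx n * t / b) by (field; lra).
    now replace (a / b * idx n * PI) with (a * idx n * PI / b) by (field; lra).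
  + apply series_eq with (1 := H3); auto; intros n.
    replace (idx n * (t / b)) with (idx n * t / b) by (field; lra).
    now replace (a / b * idx n * PI) with (a * idx n * PI / b) by (field; lra).
  + transitivity (b ^ 2 * 0); [rewrite <- H; field; lra|ring].
Qed.

Lemma half_sinh_identity (a b theta : R) :
  Rabs theta < 2 * b * PI -> a <> 0 -> 0 < b -> identity_half_sinh a b theta.
Proof.
revert a b theta; apply sign_wlog.
- intros a b t Ha Hb (S1 & S2 & S3 & H1 & H2 & H3 & H).
  (* Unlike the integer case, the left-hand side is odd in a and in theta: [S1] and [S3] change sign
     and [S2] does not. *)
  exists (- S1), S2, (- S3); split; [|split; [|split]].
  + apply series_eq with (1 := series_scal (-1) _ _ H1); [intros n|ring].
    replace ((2 * idx n - 1) * t / (2 * - a)) with (- ((2 * idx n - 1) * t / (2 * a)))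
      by (field; auto).
    replace ((2 * idx n - 1) * b * PI / (2 * - a)) with (- ((2 * idx n - 1) * b * PI / (2 * a)))
      by (field; auto).
    rewrite sinh_neg_sq, sinh_neg; unfold Rdiv; ring.
  + apply series_eq with (1 := H2); auto; intros n.
    replace (idx n * PI * - a / b) with (- (idx n * PI * a / b)) by (field; lra).
    now rewrite cosh_neg.
  + apply series_eq with (1 := series_scal (-1) _ _ H3); [intros n|ring].
    replace (idx n * PI * - a / b) with (- (idx n * PI * a / b)) by (field; lra).
    rewrite cosh_neg, sinh_neg; unfold Rdiv; ring.
  + rewrite <- Ropp_0, <- H; field.
- intros a b t Ha Hb (S1 & S2 & S3 & H1 & H2 & H3 & H).
  exists (- S1), S2, (- S3); split; [|split; [|split]].
  + apply series_eq with (1 := series_scal (-1) _ _ H1); [intros n|ring].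
    replace ((2 * idx n - 1) * - t / (2 * a)) with (- ((2 * idx n - 1) * t / (2 * a)))
      by (field; auto).
    rewrite sinh_neg; unfold Rdiv; ring.
  + apply series_eq with (1 := H2); auto; intros n.
    replace (idx n * - t / b) with (- (idx n * t / b)) by (field; lra).
    now rewrite cos_neg.
  + apply series_eq with (1 := series_scal (-1) _ _ H3); [intros n|ring].
    replace (idx n * - t / b) with (- (idx n * t / b)) by (field; lra).
    rewrite sin_neg; unfold Rdiv; ring.
  + rewrite <- Ropp_0, <- H; field.
- intros a b t Ha Hb Ht.
  destruct (odd_core (a / b) (t / b) (Rdiv_lt_0_compat _ _ Ha Hb) (angle_range _ _ Hb Ht))
    as (S1 & S2 & S3 & H1 & H2 & H3 & H).
  exists S1, S2, S3; split; [|split; [|split]].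
  + apply series_eq with (1 := H1); auto; intros n.
    replace ((2 * idx n - 1) / (2 * (a / b)) * (t / b)) with ((2 * idx n - 1) * t / (2 * a))
      by (field; lra).
    now replace ((2 * idx n - 1) / (2 * (a / b)) * PI) with ((2 * idx n - 1) * b * PI / (2 * a))
      by (field; lra).
  + apply series_eq with (1 := H2); auto; intros n.
    replace (idx n * (t / b)) with (idx n * t / b) by (field; lra).
    now replace (a / b * idx n * PI) with (idx n * PI * a / b) by (field; lra).
  + apply series_eq with (1 := H3); auto; intros n.
    replace (idx n * (t / b)) with (idx n * t / b) by (field; lra).
    now replace (a / b * idx n * PI) with (idx n * PI * a / b) by (field; lra).
  + transitivity (b ^ 2 * 0); [rewrite <- H; field; lra|ring].
Qed.

(** Applied with [f] the summand for 2 b and [g] that for b: the even-indexed terms of the former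
    are the terms of the latter, and only odd multiples of 1 / (2 b) survive the difference. *)
Lemma is_series_odd_part (f g : nat -> R) (l m : R) :
  is_series_from1 f l -> is_series_from1 g m -> (forall n, f (2 * S n)%nat = g (S n)) ->
  is_series_from1 (fun n => f (2 * n - 1)%nat) (l - m).
Proof.
intros Hf Hg E; apply is_series_odd; auto.
apply series_eq with (1 := Hg); auto; intros n; now rewrite E.
Qed.

Lemma INR_double n : INR (2 * n) = 2 * INR n.
Proof. apply mult_INR. Qed.

Lemma pos_div_neq_0 (x y : R) : 0 < x -> y <> 0 -> x / y <> 0.
Proof.
intros Hx Hy; apply Rmult_integral_contrapositive_currified; [lra|].
now apply Rinv_neq_0_compat.
Qed.

Lemma inv_cosh_sq_combination (x y s : R) : y <> 0 ->
  x / sinh y ^ 2 * s + -4 * (x / sinh (2 * y) ^ 2 * s) = x / cosh y ^ 2 * s.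
Proof. intros Hy; unfold Rdiv; rewrite inv_cosh_sq by auto; ring. Qed.

Theorem theorem3p1 (a b theta : R)
  (htheta : Rabs theta < 2 * b * PI) (ha : a <> 0) (hb : 0 < b) :
  (exists S1 S2 S3 : R,
     is_series_from1 (fun n =>
       cosh (theta * INR n / a) / sinh (b * INR n * PI / a) ^ 2 * (-1) ^ n) S1
     /\ is_series_from1 (fun n =>
       sin (INR n * theta / b) / sinh (a * INR n * PI / b)) S2
     /\ is_series_from1 (fun n =>
       cos (INR n * theta / b) * cosh (a * INR n * PI / b)
         / sinh (a * INR n * PI / b) ^ 2) S3
     /\ b ^ 2 * PI ^ 2 * S1 + theta * PI * a * S2 + a ^ 2 * PI ^ 2 * S3
        + theta ^ 2 / 4 + zeta 2 / 2 * (a ^ 2 - 2 * b ^ 2) = 0)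
  /\
  (exists S1 S2 S3 : R,
     is_series_from1 (fun n =>
       sinh ((2 * INR n - 1) * theta / (2 * a))
         / cosh ((2 * INR n - 1) * PI * b / (2 * a)) ^ 2 * (-1) ^ n) S1
     /\ is_series_from1 (fun n =>
       cos ((2 * INR n - 1) * theta / (2 * b))
         / cosh ((2 * INR n - 1) * PI * a / (2 * b))) S2
     /\ is_series_from1 (fun n =>
       sin ((2 * INR n - 1) * theta / (2 * b))
         * sinh ((2 * INR n - 1) * PI * a / (2 * b))
         / cosh ((2 * INR n - 1) * PI * a / (2 * b)) ^ 2) S3
     /\ b ^ 2 * PI ^ 2 * S1 - theta * PI * a * S2 + a ^ 2 * PI ^ 2 * S3 = 0)
  /\
  (exists S1 S2 S3 : R,
     is_series_from1 (fun n =>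
       cosh (INR n * theta / a) / cosh (INR n * PI * b / a) ^ 2 * (-1) ^ n) S1
     /\ is_series_from1 (fun n =>
       sin ((2 * INR n - 1) * theta / (2 * b))
         / sinh ((2 * INR n - 1) * PI * a / (2 * b))) S2
     /\ is_series_from1 (fun n =>
       cos ((2 * INR n - 1) * theta / (2 * b))
         * cosh ((2 * INR n - 1) * PI * a / (2 * b))
         / sinh ((2 * INR n - 1) * PI * a / (2 * b)) ^ 2) S3
     /\ b ^ 2 * PI ^ 2 * S1 - a * PI * theta * S2 - a ^ 2 * PI ^ 2 * S3
        + b ^ 2 * PI ^ 2 / 2 = 0)
  /\
  (exists S1 S2 S3 : R,
     is_series_from1 (fun n =>
       sinh ((2 * INR n - 1) * theta / (2 * a))
         / sinh ((2 * INR n - 1) * b * PI / (2 * a)) ^ 2 * (-1) ^ n) S1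
     /\ is_series_from1 (fun n =>
       cos (INR n * theta / b) / cosh (INR n * PI * a / b)) S2
     /\ is_series_from1 (fun n =>
       sin (INR n * theta / b) * sinh (INR n * PI * a / b)
         / cosh (INR n * PI * a / b) ^ 2) S3
     /\ b ^ 2 * PI ^ 2 * S1 + a * PI * theta * S2 - a ^ 2 * PI ^ 2 * S3
        + a * theta * PI / 2 = 0).
Proof.
pose proof PI_RGT_0 as Hpi.
assert (hb2 : 0 < 2 * b) by lra.
assert (htheta2 : Rabs theta < 2 * (2 * b) * PI) by nra.
assert (I := integer_sinh_identity a b theta htheta ha hb).
assert (J := half_sinh_identity a b theta htheta ha hb).
assert (I2 := integer_sinh_identity a (2 * b) theta htheta2 ha hb2).
assert (J2 := half_sinh_identity a (2 * b) theta htheta2 ha hb2).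
split; [exact I|split; [|split; [|exact J]]].
- destruct J as (S1 & S2 & S3 & H1 & H2 & H3 & H).
  destruct J2 as (T1 & T2 & T3 & G1 & G2 & G3 & G).
  (* The prefactor (2 b)^2 produces the 4 that the [cosh] formula requires. The dual series are
     subtracted the other way round, since the odd terms are those at 2 b minus those at b; this
     reverses their signs in the identity. *)
  exists (S1 - 4 * T1), (T2 - S2), (T3 - S3); split; [|split; [|split]].
  + apply series_eq with (1 := series_plus _ _ _ _ H1 (series_scal (-4) _ _ G1)); [|ring].
    intros n; pose proof (idx_ge1 n); assert (2 * a <> 0) by lra.
    replace ((2 * idx n - 1) * (2 * b) * PI / (2 * a)) with
      (2 * ((2 * idx n - 1) * PI * b / (2 * a))) by (field; auto).
    replace ((2 * idx n - 1) * b * PI / (2 * a)) with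
      ((2 * idx n - 1) * PI * b / (2 * a)) by (field; auto).
    apply inv_cosh_sq_combination.
    apply pos_div_neq_0; auto; apply Rmult_lt_0_compat; nra.
  + eapply series_eq; [apply (is_series_odd_part _ _ _ _ G2 H2)| |reflexivity]; cbv beta.
    { intros n; rewrite INR_double; f_equal; f_equal; field; lra. }
    intros n; now rewrite INR_odd.
  + eapply series_eq; [apply (is_series_odd_part _ _ _ _ G3 H3)| |reflexivity]; cbv beta.
    { intros n; rewrite INR_double;
      replace (2 * idx n * theta / (2 * b)) with (idx n * theta / b) by (field; lra);
      now replace (2 * idx n * PI * a / (2 * b)) with (idx n * PI * a / b) by (field; lra). }
    intros n; now rewrite INR_odd.
  + transitivity (0 - 0); [rewrite <- H at 1; rewrite <- G; field|ring].
- destruct I as (S1 & S2 & S3 & H1 & H2 & H3 & H).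
  destruct I2 as (T1 & T2 & T3 & G1 & G2 & G3 & G).
  exists (S1 - 4 * T1), (T2 - S2), (T3 - S3); split; [|split; [|split]].
  + apply series_eq with (1 := series_plus _ _ _ _ H1 (series_scal (-4) _ _ G1)); [|ring].
    intros n; pose proof (idx_ge1 n).
    replace (2 * b * idx n * PI / a) with (2 * (idx n * PI * b / a)) by (field; auto).
    replace (b * idx n * PI / a) with (idx n * PI * b / a) by (field; auto).
    replace (theta * idx n / a) with (idx n * theta / a) by (field; auto).
    apply inv_cosh_sq_combination.
    apply pos_div_neq_0; auto; apply Rmult_lt_0_compat; nra.
  + eapply series_eq; [apply (is_series_odd_part _ _ _ _ G2 H2)| |reflexivity]; cbv beta.
    { intros n; rewrite INR_double; f_equal; f_equal; field; lra. }
    intros n; rewrite INR_odd.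
    now replace (a * (2 * idx n - 1) * PI / (2 * b)) with
      ((2 * idx n - 1) * PI * a / (2 * b)) by (field; lra).
  + eapply series_eq; [apply (is_series_odd_part _ _ _ _ G3 H3)| |reflexivity]; cbv beta.
    { intros n; rewrite INR_double;
      replace (2 * idx n * theta / (2 * b)) with (idx n * theta / b) by (field; lra);
      now replace (a * (2 * idx n) * PI / (2 * b)) with (a * idx n * PI / b) by (field; lra). }
    intros n; rewrite INR_odd.
    now replace (a * (2 * idx n - 1) * PI / (2 * b)) with
      ((2 * idx n - 1) * PI * a / (2 * b)) by (field; lra).
  (* The terms theta^2 / 4 and a^2 zeta(2) / 2 cancel; what remains is 3 b^2 zeta(2), which equals
     b^2 PI^2 / 2 only through the value of [zeta 2]. *)
  + rewrite zeta2 in H, G.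
    transitivity (0 - 0); [rewrite <- H at 1; rewrite <- G; field|ring].
Qed.
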